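(* Let $X\sim P$ be a Borel probability measure on $\mathbb{R}^d$ and let $\alpha\in(0,\Pi(P))$ be such that $\mathrm{vol}_d(P_\alpha)>0$. Then: (i) for every non-singular $A\in\mathbb{R}^{d\times d}$, $b\in\mathbb{R}^d$ and $x\in\mathbb{R}^d$, $\mathrm{ID}_\alpha(Ax+b;P_{AX+b})=\mathrm{ID}_\alpha(x;P)$, where $P_{AX+b}$ is the law of $AX+b$; (ii) $P$ is halfspace symmetric about $x\in\mathbb{R}^d$ if and only if $\mathrm{ID}_\alpha(x;P)=(c,1)^\top$ for some $c\ge1/2$; (iii) if $x$ satisfies $\mathrm{HD}(x;P)=\Pi(P)$, then for every $u\in\mathbb{R}^d$ the first component of $\mathrm{ID}_\alpha(x+tu;P)$ is non-increasing and the second component is non-decreasing in $t\ge0$; (iv) for all $c_1,c_2\in\mathbb{R}$ the set $\{x\colon \mathrm{ID}^1_\alpha(x;P)\ge c_1,\ \mathrm{ID}^2_\alpha(x;P)\le c_2\}$ is convex, and it is compact whenever $c_1>0$; (v) $\mathrm{ID}^1_\alpha(\cdot;P)$ is upper semicontinuous, $\mathrm{ID}^2_\alpha(\cdot;P)$ is continuous on $\mathbb{R}^d$, and if $P$ has a density then $\mathrm{ID}_\alpha(\cdot;P)$ is continuous on $\mathbb{R}^d$; (vi) $\sup_{\|x\|\ge r}\mathrm{ID}^1_\alpha(x;P)\to0$ and $\inf_{\|x\|\ge r}\mathrm{ID}^2_\alpha(x;P)\to\infty$ as $r\to\infty$.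
   Context: For a Borel probability measure $P$ on $\mathbb{R}^d$ and $X\sim P$, the halfspace (Tukey) depth is $\mathrm{HD}(x;P)=\inf_{u\in\mathbb{R}^d}\Pr(u^\top X\le u^\top x)$; $\Pi(P)=\sup_{x}\mathrm{HD}(x;P)$; the central region is $P_\delta=\{x\colon\mathrm{HD}(x;P)\ge\delta\}$. For a convex body $K$, $\mathrm{Ill}(x;K)=\mathrm{vol}_d(\mathrm{conv}(K\cup\{x\}))$. The illumination depth is $\mathrm{ID}_\alpha(x;P)=(\mathrm{ID}^1_\alpha(x;P),\mathrm{ID}^2_\alpha(x;P))^\top=(\mathrm{HD}(x;P),\ \mathrm{Ill}(x;P_\alpha)/\mathrm{vol}_d(P_\alpha))^\top$. $P$ is halfspace symmetric about $x$ if every closed halfspace containing $x$ has $P$-probability at least $1/2$. *)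

(* Defs.v *)
From HB Require Import structures.
From mathcomp Require Import all_boot all_order all_algebra.
From mathcomp Require Import all_classical all_reals all_analysis.

Set Implicit Arguments.
Unset Strict Implicit.
Unset Printing Implicit Defensive.

Import Order.TTheory GRing.Theory Num.Theory.
Import numFieldNormedType.Exports.

Local Open Scope classical_set_scope.
Local Open Scope ring_scope.

Definition dotv {R : realType} {d : nat} (u x : 'rV[R]_d) : R :=
  \sum_(i < d) u ord0 i * x ord0 i.

Definition enorm {R : realType} {d : nat} (x : 'rV[R]_d) : R :=
  Num.sqrt (dotv x x).

Definition Borel_Rd (R : realType) (d : nat) :=
  g_sigma_algebraType (open : set (set 'rV[R]_d)).

Definition probfun {R : realType} {d : nat} (P : probability (Borel_Rd R d) R)
  : set 'rV[R]_d -> \bar R := fun B => P B.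

Definition law {R : realType} {d : nat} (mu : set 'rV[R]_d -> \bar R)
  (f : 'rV[R]_d -> 'rV[R]_d) : set 'rV[R]_d -> \bar R :=
  fun B => mu (f @^-1` B).

Definition halfspace_depth {R : realType} {d : nat}
  (mu : set 'rV[R]_d -> \bar R) (x : 'rV[R]_d) : R :=
  fine (ereal_inf [set mu [set y | dotv u y <= dotv u x] | u in [set: 'rV[R]_d]]).

Definition max_depth {R : realType} {d : nat} (mu : set 'rV[R]_d -> \bar R)
  : \bar R :=
  ereal_sup [set (halfspace_depth mu x)%:E | x in [set: 'rV[R]_d]].

Definition central_region {R : realType} {d : nat}
  (mu : set 'rV[R]_d -> \bar R) (delta : R) : set 'rV[R]_d :=
  [set x | delta <= halfspace_depth mu x].

Definition conv {R : realType} {d : nat} (A : set 'rV[R]_d) : set 'rV[R]_d :=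
  [set x | forall C, convex_set C -> A `<=` C -> C x].

Fixpoint iter_int {R : realType} (n : nat) : ('rV[R]_n -> \bar R) -> \bar R :=
  match n with
  | 0 => fun f => f 0
  | n'.+1 => fun f =>
      (\int[@lebesgue_measure R]_(t in [set: R])
         iter_int (fun v : 'rV[R]_n' => f (row_mx (const_mx t : 'rV[R]_1) v)))%E
  end.

(* d-dimensional Lebesgue volume vol_d(A) (for Borel A, by Tonelli). *)
Definition vol {R : realType} {d : nat} (A : set 'rV[R]_d) : \bar R :=
  iter_int (fun x => (\1_A x)%:E).

Definition illumination {R : realType} {d : nat} (x : 'rV[R]_d) (K : set 'rV[R]_d)
  : \bar R := vol (conv (K `|` [set x])).

Definition illum_depth {R : realType} {d : nat} (mu : set 'rV[R]_d -> \bar R)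
  (alpha : R) (x : 'rV[R]_d) : R * R :=
  (halfspace_depth mu x,
   fine (illumination x (central_region mu alpha)) /
   fine (vol (central_region mu alpha))).

Definition halfspace_symmetric {R : realType} {d : nat}
  (mu : set 'rV[R]_d -> \bar R) (x : 'rV[R]_d) : Prop :=
  forall (u : 'rV[R]_d) (c : R), u != 0 -> dotv u x <= c ->
    ((1/2)%:E <= mu [set y | (dotv u y <= c)%R])%E.

Definition upper_semicontinuous {R : realType} {d : nat} (f : 'rV[R]_d -> R) :=
  forall x a, f x < a -> exists2 V, nbhs x V & forall y, V y -> f y < a.

Definition has_density {R : realType} {d : nat} (P : probability (Borel_Rd R d) R)
  : Prop :=
  exists f : Borel_Rd R d -> R,
    [/\ measurable_fun setT f, (forall y, 0 <= f y) &
        forall B : set (Borel_Rd R d), measurable B ->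
          P B = iter_int (fun y => (f y * \1_B y)%:E)].

(* Main.v *)
(* The iterated integral defining the volume is integration against a
   sigma-finite Borel measure that is translation invariant, hence is multiplied
   by a positive constant under an invertible linear map: this gives affine
   invariance.

   The central region K is compact and convex, as the depth is upper
   semicontinuous, quasiconcave and vanishes at infinity.  The key point is that
   x |-> vol(conv(K u {x})) is convex: moving x along a line in direction e, the
   hull is a shadow system, and its chords parallel to e have lengths convex in
   the position of x, so that Tonelli in coordinates adapted to e applies.  A
   finite convex function is continuous; being minimal on K it increases along
   rays from a deepest point; and since the hull gains the homothetic copy
   (K + x)/2 when x is far from K, it grows at least linearly.

   With a density, hyperplanes are null, and compactness of the sphere of
   directions makes the depth lower semicontinuous. *)
Require Import Defs.
From HB Require Import structures.
From mathcomp Require Import all_boot all_order all_algebra.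
From mathcomp Require Import all_classical all_reals all_analysis.
From mathcomp Require Import measurable_realfun ring lra.
Import Order.TTheory GRing.Theory Num.Theory.
Import numFieldNormedType.Exports.
Set Implicit Arguments.
Unset Strict Implicit.
Unset Printing Implicit Defensive.
Local Open Scope classical_set_scope.
Local Open Scope ring_scope.

Local Notation borel := (@measurable _ (Borel_Rd _ _)).
Local Notation borel_fun f := (measurable_fun [set: Borel_Rd _ _] f).

Section LevelSets.
Context {R : realType} {T : topologicalType}.
Variable f : T -> R.
Hypothesis f_continuous : continuous f.
Implicit Type c : R.

Lemma closed_sublevel c : closed [set x | f x <= c].
Proof.
rewrite (_ : [set _ | _] = f @^-1` [set t | t <= c])//.
by apply: preimage_closed; [move=> x _; exact: f_continuous|exact: closed_le].
Qed.

Lemma closed_superlevel c : closed [set x | c <= f x].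
Proof.
rewrite (_ : [set _ | _] = f @^-1` [set t | c <= t])//.
by apply: preimage_closed; [move=> x _; exact: f_continuous|exact: closed_ge].
Qed.

Lemma closed_level c : closed [set x | f x = c].
Proof.
rewrite (_ : [set _ | _] = f @^-1` [set t | t = c])//.
by apply: preimage_closed; [move=> x _; exact: f_continuous|exact: closed_eq].
Qed.

Lemma open_strict_sublevel c : open [set x | f x < c].
Proof.
rewrite (_ : [set _ | _] = f @^-1` [set t | t < c])//.
by apply: open_comp; [move=> x _; exact: f_continuous|exact: open_lt].
Qed.

End LevelSets.

Lemma semicontinuous_continuous {R : realType} {T : topologicalType}
    (f : T -> R) :
  (forall x a, f x < a -> \forall y \near x, f y < a) ->
  (forall x a, a < f x -> \forall y \near x, a < f y) -> continuous f.
Proof.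
move=> usc lsc x; apply/cvgrPdist_lt => e e0.
have f_lt : \forall y \near x, f y < f x + e by apply: usc; rewrite ltrDl.
have f_gt : \forall y \near x, f x - e < f y.
  by apply: lsc; rewrite ltrBlDr ltrDl.
apply: filterS2 f_lt f_gt => y ylt ygt.
by rewrite ltr_norml; apply/andP; split; lra.
Qed.

Section BorelSets.
Context {R : realType} {n : nat}.
Implicit Types U C : set 'rV[R]_n.

Lemma open_borel U : open U -> borel U.
Proof. exact: sub_sigma_algebra. Qed.

Lemma closed_borel C : closed C -> borel C.
Proof.
move=> cC; rewrite -(setCK C); apply: measurableC.
by apply: open_borel; exact: closed_openC.
Qed.

Lemma compact_borel C : compact C -> borel C.
Proof.
by move=> cC; apply: closed_borel; apply: compact_closed => //;
  exact: norm_hausdorff.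
Qed.

Lemma continuous_borel_fun (f : 'rV[R]_n -> R) : continuous f -> borel_fun f.
Proof.
move=> cf; apply: (measurability _ (RGenOpens.measurableE R)).
move=> _ [_ [a [b ->] <-]]; rewrite setTI; apply: open_borel.
by apply: open_comp; [move=> ? _; exact: cf | exact: interval_open].
Qed.

Lemma measurable_coord (i : 'I_n) : borel_fun (fun x : 'rV[R]_n => x ord0 i).
Proof. by apply: continuous_borel_fun; exact: coord_continuous. Qed.

End BorelSets.

Section MeasurableRowVectors.
Context {R : realType}.

Definition rational_ball n (c : 'rV[rat]_n * nat) : set 'rV[R]_n :=
  ball (map_mx ratr c.1 : 'rV[R]_n) c.2.+1%:R^-1.

Lemma dense_rational_rV n (x : 'rV[R]_n) e : 0 < e ->
  exists q : 'rV[rat]_n, ball (map_mx ratr q : 'rV[R]_n) e x.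
Proof.
move=> e0.
have /choice[q xq] (i : 'I_n) : exists q : rat, ball (ratr q : R) e (x ord0 i).
  have /(@rat_in_itvoo R)[q] : x ord0 i < x ord0 i + e by rewrite ltrDl.
  rewrite in_itv/= => /andP[xq qx]; exists q.
  by rewrite /ball/= ger0_norm ?subr_ge0 ?ltW// ltrBlDl.
by exists (\row_i q i); split => // i j; rewrite !mxE (ord1 i).
Qed.

Lemma open_bigcup_rational_ball n (U : set 'rV[R]_n) : open U ->
  U = \bigcup_(c in [set c | rational_ball c `<=` U]) rational_ball c.
Proof.
move=> oU; apply/seteqP; split => [x Ux|x [c cU /cU]//].
have /nbhs_ballP[e /= e0 eU] := open_nbhs_nbhs (conj oU Ux).
have [k] : exists k : nat, k.+1%:R^-1 < e / 2.
  have /ltr_add_invr[k] : 0 < e / 2 by rewrite divr_gt0.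
  by rewrite add0r; exists k.
move=> /ltW ke; have [|q qx] := @dense_rational_rV _ x k.+1%:R^-1; first by [].
exists (q, k) => //= y qy; apply: eU.
by apply: ball_split (le_ball ke qy); exact: le_ball ke _ (ball_sym qx).
Qed.

Context {d} {T : measurableType d}.

Lemma measurable_fun_rV n (F : T -> Borel_Rd R n) :
  (forall i, measurable_fun setT (fun t => (F t : 'rV[R]_n) ord0 i)) ->
  measurable_fun setT F.
Proof.
move=> mF; pose opens : set (set (Borel_Rd R n)) := (open : set (set 'rV[R]_n)).
apply: (@measurability _ _ _ _ setT F opens erefl) => _ [U oU <-].
rewrite setTI (open_bigcup_rational_ball oU) preimage_bigcup bigcup_mkcond.
apply: countable_bigcupT_measurable => // c; case: ifP => // _.
rewrite (_ : F @^-1` _ = \bigcap_i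
    ((fun t => (F t : 'rV[R]_n) ord0 i) @^-1`
     ball (ratr (c.1 ord0 i) : R) c.2.+1%:R^-1)).
  apply: fin_bigcap_measurable => // i _; rewrite -[X in measurable X]setTI.
  by apply: mF => //; apply: open_measurable; exact: ball_open.
apply/seteqP; split => [t [_ cF] i _|t cF].
  by have := cF ord0 i; rewrite mxE.
by split => // i j; rewrite mxE (ord1 i); exact: cF.
Qed.

Lemma measurable_addrV n (f g : T -> Borel_Rd R n) :
  measurable_fun setT f -> measurable_fun setT g ->
  measurable_fun setT
    (fun t => (f t : 'rV[R]_n) + (g t : 'rV[R]_n) : Borel_Rd R n).
Proof.
move=> mf mg; apply: measurable_fun_rV => i; under eq_fun do rewrite mxE.
by apply: measurable_funD; exact: measurableT_comp (measurable_coord i) _.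
Qed.

Lemma measurable_mulmxr m n (A : 'M[R]_(m, n)) (f : T -> Borel_Rd R m) :
  measurable_fun setT f ->
  measurable_fun setT (fun t => (f t : 'rV[R]_m) *m A : Borel_Rd R n).
Proof.
move=> mf; apply: measurable_fun_rV => i; under eq_fun do rewrite mxE.
apply: measurable_sum => j; apply: measurable_funM => //.
exact: measurableT_comp (measurable_coord j) _.
Qed.

End MeasurableRowVectors.

Section AffinePreimages.
Context {R : realType} {n : nat}.
Implicit Types (E : set 'rV[R]_n) (a : 'rV[R]_n) (A : 'M[R]_n).

Lemma borel_preimage_shift a E : borel E -> borel (shift a @^-1` E).
Proof.
move=> mE; rewrite -[X in measurable X]setTI.
have : borel_fun (shift a : Borel_Rd R n -> Borel_Rd R n).
  exact: measurable_addrV.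
exact.
Qed.

Lemma borel_preimage_mulmxr A E : borel E -> borel (mulmxr A @^-1` E).
Proof.
move=> mE; rewrite -[X in measurable X]setTI.
have : borel_fun (mulmxr A : Borel_Rd R n -> Borel_Rd R n).
  exact: measurable_mulmxr.
exact.
Qed.

End AffinePreimages.

Section RowCons.
Context {R : realType} {n : nat}.
Implicit Types (t : R) (v : 'rV[R]_n).

Definition row_cons t v : 'rV[R]_n.+1 := row_mx (const_mx t : 'rV[R]_1) v.

Lemma row_cons_head t v : row_cons t v ord0 ord0 = t.
Proof. by rewrite mxE; case: splitP => //= i _; rewrite mxE. Qed.

Lemma row_cons_tail t v i : row_cons t v ord0 (lift ord0 i) = v ord0 i.
Proof.
have -> : lift ord0 i = rshift 1 i by apply/val_inj.
by rewrite /row_cons (@row_mxEr _ 1 1 n).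
Qed.

Lemma col'_row_cons t v : col' ord0 (row_cons t v) = v.
Proof. by apply/rowP => i; rewrite mxE row_cons_tail. Qed.

Lemma row_cons_uncons (x : 'rV[R]_n.+1) :
  row_cons (x ord0 ord0) (col' ord0 x) = x.
Proof.
apply/rowP => i; case: (unliftP ord0 i) => [j|] ->; last exact: row_cons_head.
by rewrite row_cons_tail mxE.
Qed.

Lemma row_consD t1 t2 v1 v2 :
  row_cons (t1 + t2) (v1 + v2) = row_cons t1 v1 + row_cons t2 v2.
Proof.
apply/rowP => i; rewrite [RHS]mxE; case: (unliftP ord0 i) => [j|] ->.
  by rewrite !row_cons_tail mxE.
by rewrite !row_cons_head.
Qed.

Lemma measurable_row_cons : measurable_fun setT
  (fun p : measurableTypeR R * Borel_Rd R n =>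
    row_cons p.1 p.2 : Borel_Rd R n.+1).
Proof.
apply: measurable_fun_rV => i; case: (unliftP ord0 i) => [j|] ->.
  under eq_fun do rewrite row_cons_tail.
  exact: measurableT_comp (measurable_coord j) _.
under eq_fun do rewrite row_cons_head; exact: measurable_fst.
Qed.

Lemma measurable_row_uncons : measurable_fun setT
  (fun x : Borel_Rd R n.+1 => ((x : 'rV[R]_n.+1) ord0 ord0 : measurableTypeR R,
                              col' ord0 (x : 'rV[R]_n.+1) : Borel_Rd R n)).
Proof.
apply: measurable_fun_pair; first exact: measurable_coord.
apply: measurable_fun_rV => i; under eq_fun do rewrite mxE.
exact: measurable_coord.
Qed.

Lemma measurable_row_consr t :
  measurable_fun setT (row_cons t : Borel_Rd R n -> Borel_Rd R n.+1).
Proof. exact: measurableT_comp measurable_row_cons (pair1_measurable t). Qed.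

End RowCons.

Lemma sigma_finite_pushforward d1 d2 (T1 : measurableType d1)
    (T2 : measurableType d2) (R : realType) (m : set T1 -> \bar R)
    (f : T1 -> T2) (g : T2 -> T1) :
  measurable_fun setT g -> cancel f g -> sigma_finite setT m ->
  sigma_finite setT (pushforward m f).
Proof.
move=> mg fK [F FT mF].
exists (fun k => g @^-1` F k) => [|k]; first by rewrite -preimage_bigcup -FT.
have [mFk Fk_fin] := mF k; split.
  by rewrite -[X in measurable X]setTI; exact: mg.
have gfE : g \o f = id by exact/funext.
by rewrite /pushforward -comp_preimage gfE preimage_id.
Qed.

(* Instance inference on [m1 \x m2] does not find the sigma-finite structure: it
   is shadowed by the one for products of subprobabilities. *)
Lemma sigma_finite_product d1 d2 (T1 : measurableType d1)
    (T2 : measurableType d2) (R : realType)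
    (m1 : {sigma_finite_measure set T1 -> \bar R})
    (m2 : {sigma_finite_measure set T2 -> \bar R}) :
  sigma_finite setT (m1 \x m2)%E.
Proof.
have /sigma_finiteP[F [FT ndF F_fin]] := sigma_finiteT m1.
have /sigma_finiteP[G [GT ndG G_fin]] := sigma_finiteT m2.
exists (fun k => F k `*` G k) => [|k].
  apply/esym; rewrite -subTset => -[x y] _.
  have [i _ Fx] : (\bigcup_k F k) x by rewrite -FT.
  have [j _ Gy] : (\bigcup_k G k) y by rewrite -GT.
  exists (maxn i j) => //; split => /=.
    by move/subsetPset: (ndF _ _ (leq_maxl i j)); exact.
  by move/subsetPset: (ndG _ _ (leq_maxr i j)); exact.
have [mF Fk_fin] := F_fin k; have [mG Gk_fin] := G_fin k.
split; first exact: measurableX.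
by rewrite product_measure1E// lte_mul_pinfty// ge0_fin_numE.
Qed.

Section VolumeSucc.
Context {R : realType} {n : nat}.
Variable m : {sigma_finite_measure set (Borel_Rd R n) -> \bar R}.

Definition volume_succ : set (Borel_Rd R n.+1) -> \bar R :=
  pushforward (lebesgue_measure \x m)%E
    (fun p => row_cons p.1 p.2 : Borel_Rd R n.+1).

(* The measure structure on [pushforward] takes the measurability of the map
   from the context. *)
Let mrow_cons := @measurable_row_cons R n.

Let volume_succ0 : volume_succ set0 = 0%E.
Proof. exact: measure0. Qed.

Let volume_succ_ge0 A : (0 <= volume_succ A)%E.
Proof. exact: measure_ge0. Qed.

Let volume_succ_sigma_additive : semi_sigma_additive volume_succ.
Proof. exact: measure_semi_sigma_additive. Qed.

HB.instance Definition _ := isMeasure.Build _ _ _ volume_succ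
  volume_succ0 volume_succ_ge0 volume_succ_sigma_additive.

Let volume_succ_sigma_finite : sigma_finite setT volume_succ.
Proof.
apply: (@sigma_finite_pushforward _ _ _ _ _ (lebesgue_measure \x m)%E _ _
  measurable_row_uncons); last exact: sigma_finite_product.
by move=> [t v] /=; rewrite row_cons_head col'_row_cons.
Qed.

HB.instance Definition _ := Measure_isSigmaFinite.Build _ _ _ volume_succ
  volume_succ_sigma_finite.

End VolumeSucc.

Section Volume.
Context {R : realType}.

Lemma volume_exists n :
  exists m : {sigma_finite_measure set (Borel_Rd R n) -> \bar R},
  forall f : 'rV[R]_n -> \bar R, borel_fun f ->
    (forall x, 0 <= f x)%E -> iter_int f = (\int[m]_x f x)%E.
Proof.
elim: n => [|n [m iter_intm]].
  exists (\d_(0 : Borel_Rd R 0)) => f mf f0 /=.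
  by rewrite integral_dirac// diracT mul1e.
exists (volume_succ m) => f mf f0 /=.
rewrite (ge0_integral_pushforward measurable_row_cons)//.
rewrite preimage_setT fubini_tonelli1//; last by move=> x; exact: f0.
  apply: eq_integral => t _; apply: iter_intm => //.
  exact: measurableT_comp mf (measurable_row_consr t).
exact: measurableT_comp mf measurable_row_cons.
Qed.

Definition volume n : {sigma_finite_measure set (Borel_Rd R n) -> \bar R} :=
  sval (cid (volume_exists n)).

Lemma iter_intE n (f : 'rV[R]_n -> \bar R) :
  borel_fun f -> (forall x, 0 <= f x)%E ->
  iter_int f = (\int[volume n]_x f x)%E.
Proof. exact: svalP (cid (volume_exists n)) f. Qed.

Lemma integral_volumeS n (f : 'rV[R]_n.+1 -> \bar R) :
  borel_fun f -> (forall x, 0 <= f x)%E ->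
  (\int[volume n.+1]_x f x =
   \int[lebesgue_measure]_t \int[volume n]_v f (row_cons t v))%E.
Proof.
move=> mf f0; rewrite -iter_intE//=; apply: eq_integral => t _.
apply: iter_intE => //.
exact: measurableT_comp mf (measurable_row_consr t).
Qed.

Lemma volume_integral_indic n (E : set (Borel_Rd R n)) : measurable E ->
  volume n E = (\int[volume n]_x (\1_E x)%:E)%E.
Proof. by move=> mE; rewrite integral_indic// setIT. Qed.

Lemma volE n (E : set 'rV[R]_n) : borel E -> vol E = volume n E.
Proof.
by move=> mE; rewrite (volume_integral_indic mE) -iter_intE//;
  exact/measurable_EFinP.
Qed.

End Volume.

Section TranslationInvariance.
Context {R : realType}.

Lemma lebesgue_integral_shift (c : R) (f : R -> \bar R) :
  measurable_fun setT f -> (forall t, 0 <= f t)%E ->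
  (\int[lebesgue_measure]_t f (t + c)%R = \int[lebesgue_measure]_t f t)%E.
Proof.
move=> mf f0.
pose shiftc : measurableTypeR R -> measurableTypeR R := fun t => t + c.
have mshift : measurable_fun setT shiftc by exact: measurable_funD.
rewrite -[LHS](@ge0_integral_pushforward _ _ _ _ _ _ mshift
  lebesgue_measure setT f)//.
apply: eq_measure_integral => A mA _ /=.
apply/esym/lebesgue_measure_unique => //= _ [[a b]] _ <-.
rewrite /pushforward (_ : _ @^-1` _ = `](a - c), (b - c)]%classic).
  rewrite !lebesgue_measure_itv/= !lte_fin ltrD2r; case: ifP => // _.
  by rewrite -!EFinB; congr EFin; ring.
by apply/seteqP; split=> t/=; rewrite !in_itv/= ltrBlDr lerBrDr.
Qed.

Lemma measurable_shiftr n (a : 'rV[R]_n) d (T : measurableType d)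
    (f : 'rV[R]_n -> T) :
  borel_fun f -> borel_fun (fun x => f (x + a)).
Proof. by move=> mf; apply: (measurableT_comp mf); exact: measurable_addrV. Qed.

Lemma integral_volume_shift n (a : 'rV[R]_n) (f : 'rV[R]_n -> \bar R) :
  borel_fun f -> (forall x, 0 <= f x)%E ->
  (\int[volume n]_x f (x + a)%R = \int[volume n]_x f x)%E.
Proof.
elim: n a f => [a f mf f0|n IHn a f mf f0].
  by apply: eq_integral => x _; congr f; apply/rowP => -[].
rewrite [RHS](integral_volumeS mf)//.
rewrite [LHS](integral_volumeS (measurable_shiftr a mf))//.
pose F t := (\int[volume n]_v f (row_cons t v))%E.
transitivity (\int[lebesgue_measure]_t F (t + a ord0 ord0)%R)%E.
  apply: eq_integral => t _; rewrite -{1}(row_cons_uncons a).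
  under eq_integral do rewrite -row_consD.
  apply: (IHn (col' ord0 a) (fun v => f (row_cons (t + a ord0 ord0) v))) => //.
  exact: measurableT_comp mf (measurable_row_consr _).
apply: lebesgue_integral_shift => [|t]; last exact: integral_ge0.
have mfcons := measurableT_comp mf measurable_row_cons.
have := @measurable_fun_fubini_tonelli_F _ _ (measurableTypeR R) (Borel_Rd R n)
  R (volume n) _ mfcons (fun=> f0 _).
exact.
Qed.

Lemma volume_shift n (a : 'rV[R]_n) (E : set 'rV[R]_n) : borel E ->
  volume n (shift a @^-1` E) = volume n E.
Proof.
move=> mE; have mEa := borel_preimage_shift a mE.
rewrite (volume_integral_indic mE) (volume_integral_indic mEa).
rewrite -(@integral_volume_shift n a (fun x => (\1_E x)%:E))//.
exact/measurable_EFinP.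
Qed.

End TranslationInvariance.

Section CenteredBall.
Context {R : realType}.
Implicit Types (M : R) (n : nat).

Definition cball n M : set 'rV[R]_n := [set x | `|x| <= M].

Lemma compact_sub_cball n (K : set 'rV[R]_n) : compact K ->
  exists2 M, 0 < M & K `<=` cball M.
Proof.
move=> /compact_bounded/ex_strict_bound_gt0[M M0 KM].
by exists M => // x /KM/ltW.
Qed.

Lemma closed_sub_cball_compact n (K : set 'rV[R]_n) M : closed K ->
  K `<=` cball M -> compact K.
Proof.
move=> cK KM; apply: bounded_closed_compact cK.
exists M; split; first exact: num_real.
by move=> N MN x /KM/le_trans; apply; exact: ltW.
Qed.

Lemma rV_norm_le n (x : 'rV[R]_n) M : 0 <= M ->
  `|x| <= M <-> forall i, `|x ord0 i| <= M.
Proof.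
move=> M0; rewrite /Num.norm/= mx_normrE; split => [/bigmax_leP[_ xM] i|xM].
  exact: (xM (ord0, i)).
by apply/bigmax_leP; split => // -[i j] _ /=; rewrite (ord1 i) xM.
Qed.

Lemma normr_coord n (x : 'rV[R]_n) i : `|x ord0 i| <= `|x|.
Proof. exact: (proj1 (rV_norm_le x (normr_ge0 x)) (lexx _)). Qed.

Lemma normr_row_cons n t (v : 'rV[R]_n) M : 0 <= M ->
  `|row_cons t v| <= M <-> `|t| <= M /\ `|v| <= M.
Proof.
move=> M0; rewrite !rV_norm_le//; split => [tvM|[tM vM] i].
  split=> [|i]; first by have := tvM ord0; rewrite row_cons_head.
  by have := tvM (lift ord0 i); rewrite row_cons_tail.
by case: (unliftP ord0 i) => [j|] ->; rewrite ?row_cons_tail ?row_cons_head.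
Qed.

Lemma borel_cball n M : borel (@cball n M).
Proof.
by apply: closed_borel; apply: closed_sublevel => x; exact: norm_continuous.
Qed.

Lemma indic_cball_row_cons n t (v : 'rV[R]_n) M : 0 <= M ->
  \1_(cball M) (row_cons t v) = \1_`[- M, M]%classic t * \1_(cball M) v :> R.
Proof.
move=> M0; rewrite !indicE -natrM mulnb; congr (nat_of_bool _)%:R.
apply/idP/andP.
  move=> /set_mem/normr_row_cons-/(_ M0)[tM vM].
  by split; apply/mem_set => //=; rewrite in_itv/= -ler_norml.
move=> [/set_mem/=]; rewrite in_itv/= -ler_norml => tM /set_mem vM.
by apply/mem_set/normr_row_cons.
Qed.

Lemma volume_cball n M : 0 <= M -> volume n (cball M) = ((M *+ 2) ^+ n)%:E.
Proof.
move=> M0; elim: n => [|n IHn].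
  rewrite -volE; last exact: borel_cball.
  by rewrite /vol/= indicE mem_set//= /cball/= normr0.
have mcball k := @borel_cball k M.
rewrite (volume_integral_indic (mcball n.+1)) integral_volumeS//; last first.
  exact/measurable_EFinP/measurable_indic.
have integral_slice t : (\int[volume n]_v (\1_(cball M) (row_cons t v))%:E =
    (\1_`[- M, M]%classic t)%:E * ((M *+ 2) ^+ n)%:E)%E.
  under eq_integral do rewrite indic_cball_row_cons// EFinM.
  rewrite ge0_integralZl//; last exact/measurable_EFinP/measurable_indic.
  by rewrite -volume_integral_indic// IHn.
under eq_integral do rewrite integral_slice.
rewrite ge0_integralZr//; last 2 first.
- exact/measurable_EFinP/measurable_indic.
- by rewrite lee_fin exprn_ge0// mulrn_wge0.
rewrite integral_indic//= setIT lebesgue_measure_itv/= lte_fin.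
case: ltrP => [_|M_le_opp].
  by rewrite -EFinB -EFinM exprSr opprK mulr2n mulrC.
have -> : M = 0 by lra.
by rewrite mul0e mul0rn expr0n.
Qed.

End CenteredBall.

Section LinearInvariance.
Context {R : realType} {n : nat}.
Implicit Types (f g : 'rV[R]_n -> \bar R) (A : 'M[R]_n) (E F : set 'rV[R]_n).
Local Open Scope ereal_scope.

Lemma measurable_shear f g A : borel_fun f -> borel_fun g ->
  measurable_fun [set: Borel_Rd R n * Borel_Rd R n]
    (fun p => f p.1 * g (p.1 + p.2 *m A)%R).
Proof.
move=> mf mg; apply: emeasurable_funM; first exact: measurableT_comp.
apply: (measurableT_comp mg); apply: measurable_addrV => //.
exact: measurable_mulmxr.
Qed.

Lemma integral_volume_shear f g A : A \in unitmx ->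
  borel_fun f -> (forall x, 0 <= f x) -> borel_fun g -> (forall x, 0 <= g x) ->
  \int[volume n]_x \int[volume n]_y (f x * g (x + y *m A)%R) =
  (\int[volume n]_x f x) * \int[volume n]_y g (y *m A).
Proof.
move=> uA mf f0 mg g0; have mgA : borel_fun (g \o mulmxr A).
  by apply: (measurableT_comp mg); exact: measurable_mulmxr.
have integral_y x : \int[volume n]_y (f x * g (x + y *m A)%R) =
    f x * \int[volume n]_y g (y *m A).
  have shiftA y : g (x + y *m A)%R = (g \o mulmxr A) (y + x *m invmx A)%R.
    by rewrite /= mulmxDl mulmxKV// addrC.
  under eq_integral do rewrite shiftA.
  rewrite ge0_integralZl//; last 2 first.
  - exact: (measurable_shiftr (x *m invmx A) mgA).
  - by move=> y _; exact: g0.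
  by congr (_ * _); exact: (integral_volume_shift _ mgA (fun=> g0 _)).
under eq_integral do rewrite integral_y.
by rewrite ge0_integralZr//; exact: integral_ge0.
Qed.

Lemma integral_volume_shear_swap f g A :
  borel_fun f -> (forall x, 0 <= f x) -> borel_fun g -> (forall x, 0 <= g x) ->
  \int[volume n]_x \int[volume n]_y (f x * g (x + y *m A)%R) =
  \int[volume n]_x \int[volume n]_y (g x * f (x + y *m (- A))%R).
Proof.
move=> mf f0 mg g0.
rewrite (fubini_tonelli _ (measurable_shear A mf mg))/=;
  last by move=> p; exact: mule_ge0.
rewrite (fubini_tonelli _ (measurable_shear (- A) mg mf))/=;
  last by move=> p; exact: mule_ge0.
apply: eq_integral => y _.
have mfgy := measurableT_comp (measurable_shear A mf mg) (pair2_measurable y).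
rewrite -(@integral_volume_shift R n ((y : 'rV[R]_n) *m (- A)) _ mfgy);
  last by move=> x; exact: mule_ge0.
by apply: eq_integral => x _ /=;
  rewrite muleC -addrA -mulmxDr addNr mulmx0 addr0.
Qed.

(* Weil's proof of the uniqueness of Haar measure, specialized to the image of
   the volume under a linear bijection: integrate [1_F x * 1_E (x + y *m A)] in
   both orders. *)
Lemma volume_mulmx_swap A E F : A \in unitmx -> borel E -> borel F ->
  volume n F * volume n (mulmxr A @^-1` E) =
  volume n E * volume n (mulmxr (- A) @^-1` F).
Proof.
move=> uA mE mF.
have uNA : (- A)%R \in unitmx by rewrite -scaleN1r unitmxZ// unitrN1.
pose indic (C : set 'rV[R]_n) x : \bar R := (\1_C x)%:E.
have mindic C : borel C -> borel_fun (indic C).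
  by move=> mC; exact/measurable_EFinP/measurable_indic.
have indic_ge0 C x : 0 <= indic C x by rewrite lee_fin.
have := integral_volume_shear_swap A
  (mindic F mF) (indic_ge0 F) (mindic E mE) (indic_ge0 E).
rewrite !integral_volume_shear//; try exact: mindic.
by rewrite !volume_integral_indic//; exact: borel_preimage_mulmxr.
Qed.

(* The factor is [`|\det A|^-1], but only its positivity is needed. *)
Lemma volume_mulmx A : A \in unitmx ->
  exists2 c : R, (0 < c)%R & forall E, borel E ->
    volume n (mulmxr A @^-1` E) = c%:E * volume n E.
Proof.
move=> uA; pose Q : set 'rV[R]_n := cball 2^-1.
have mQ : borel Q := @borel_cball R n _.
have vQ : volume n Q = 1.
  rewrite volume_cball ?invr_ge0//.
  by rewrite -(mulr_natr 2^-1) mulVf ?pnatr_eq0// expr1n.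
pose c := volume n (mulmxr (- A) @^-1` Q).
have scale E : borel E -> volume n (mulmxr A @^-1` E) = c * volume n E.
  by move=> mE; have := volume_mulmx_swap uA mE mQ; rewrite vQ mul1e muleC.
have cQ : 1 = c * volume n (mulmxr (invmx A) @^-1` Q).
  rewrite -scale; last exact: borel_preimage_mulmxr.
  rewrite -comp_preimage -vQ; congr (volume n _).
  by apply/funext => x /=; rewrite mulmxK.
have c_ge0 : 0 <= c by exact: measure_ge0.
have c_neq0 : c != 0.
  by apply/eqP => c0; move/eqP: cQ; rewrite c0 mul0e onee_eq0.
have c_fin : c \is a fin_num.
  rewrite ge0_fin_numE// ltey; apply/eqP => cy; move/eqP: cQ; rewrite cy.
  have := measure_ge0 (volume n) (mulmxr (invmx A) @^-1` Q).
  by rewrite le_eqVlt => /predU1P[<-|/gt0_mulye ->]//; rewrite mule0 onee_eq0.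
exists (fine c) => [|E mE]; last by rewrite fineK// scale.
by rewrite fine_gt0// lt_neqAle eq_sym c_neq0 c_ge0 ltey_eq c_fin.
Qed.

End LinearInvariance.

Lemma volume_affine {R : realType} {n : nat} (A : 'M[R]_n) : A \in unitmx ->
  exists2 c : R, 0 < c & forall (a : 'rV[R]_n) E, borel E ->
    volume n ((fun x => (x + a) *m A) @^-1` E) = (c%:E * volume n E)%E.
Proof.
move=> /volume_mulmx[c c0 scale]; exists c => // a E mE.
by rewrite -scale// -(volume_shift a (borel_preimage_mulmxr A mE)).
Qed.

Section ConvexSets.
Context {R : realType} {V : lmodType R}.
Implicit Types (C K : set V) (x y : V) (f : V -> R).

Lemma convex_setP C : convex_set C <->
  forall x y t, 0 <= t -> t <= 1 -> C x -> C y -> C ((1 - t) *: x + t *: y).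
Proof.
split=> [cC x y t t0 t1 Cx Cy|cC x y t /set_mem Cx /set_mem Cy].
  have /set_mem := cC y x (Itv01 t0 t1) (mem_set Cy) (mem_set Cx).
  by rewrite addrC.
apply/mem_set; suff : C ((1 - t%:num) *: y + t%:num *: x) by rewrite addrC.
exact: cC.
Qed.

Lemma convex_functionP f : convex_function [set: convex_lmodType V] f <->
  forall x y t, 0 <= t -> t <= 1 ->
    f ((1 - t) *: x + t *: y) <= (1 - t) * f x + t * f y.
Proof.
split=> [cf x y t t0 t1|cf t x y _ _].
  have := cf (Itv01 t0 t1) y x (in_setT _) (in_setT _).
  by rewrite addrC [leRHS]addrC.
suff : f ((1 - t%:num) *: y + t%:num *: x) <= (1 - t%:num) * f y + t%:num * f x.
  by rewrite addrC [leRHS]addrC.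
exact: cf.
Qed.

Lemma convex_sublevel f c : convex_function [set: convex_lmodType V] f ->
  convex_set [set x | f x <= c].
Proof.
move=> /convex_functionP cf; apply/convex_setP => x y t t0 t1 /= fx fy.
by apply: le_trans (cf _ _ _ t0 t1) _; nra.
Qed.

Lemma convex_setI C K : convex_set C -> convex_set K -> convex_set (C `&` K).
Proof.
move=> /convex_setP cC /convex_setP cK.
apply/convex_setP => x y t t0 t1 [Cx Kx] [Cy Ky].
by split; [exact: cC|exact: cK].
Qed.

Definition point_join K x : set V :=
  [set y | exists k t, [/\ K k, 0 <= t, t <= 1 & y = (1 - t) *: k + t *: x]].

Lemma sub_point_join K x : K `<=` point_join K x.
Proof.
by move=> k Kk; exists k, 0; split=> //; rewrite subr0 scale1r scale0r addr0.
Qed.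

Lemma point_join_apex K x : K !=set0 -> point_join K x x.
Proof.
by move=> [k Kk]; exists k, 1; split=> //; rewrite subrr scale1r scale0r add0r.
Qed.

Lemma point_join_id K x : convex_set K -> K x -> point_join K x = K.
Proof.
move=> /convex_setP cK Kx; apply/seteqP; split; last exact: sub_point_join.
by move=> _ [k [t [Kk t0 t1 ->]]]; exact: cK.
Qed.

(* The coefficients of [x] combine to [s]; the remaining mass [1 - s] is shared
   by the points of [K] in the ratio [1 - r : r]. *)
Lemma convex_point_join K x : convex_set K -> convex_set (point_join K x).
Proof.
move=> /convex_setP cK; apply/convex_setP.
move=> _ _ t t0 t1 [k [a [Kk a0 a1 ->]]] [l [b [Kl b0 b1 ->]]].
pose s := (1 - t) * a + t * b.
have s0 : 0 <= s by rewrite addr_ge0// mulr_ge0// subr_ge0.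
have s1 : s <= 1 by rewrite /s; nra.
suff [r [r0 r1 rk rl]] : exists r, [/\ 0 <= r, r <= 1,
    (1 - s) * (1 - r) = (1 - t) * (1 - a) & (1 - s) * r = t * (1 - b)].
  exists ((1 - r) *: k + r *: l), s; split => //; first exact: cK.
  by rewrite !scalerDr !scalerA rk rl addrACA -scalerDl.
have [s_eq1|s_neq1] := eqVneq s 1.
  by exists 0; split => //; move: s_eq1; rewrite /s => s_eq1; nra.
have s_lt1 : 0 < 1 - s by rewrite subr_gt0 lt_neqAle s_neq1.
exists (t * (1 - b) / (1 - s)); split.
- by rewrite divr_ge0 ?mulr_ge0 ?subr_ge0.
- by rewrite ler_pdivrMr// mul1r /s; nra.
- by rewrite /s; field; rewrite gt_eqF.
- by field; rewrite gt_eqF.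
Qed.

End ConvexSets.

Lemma compact_point_join {R : realType} {V : normedModType R} (K : set V)
    (x : V) : compact K -> compact (point_join K x).
Proof.
move=> cK; pose f (p : V * R) : V := (1 - p.2) *: p.1 + p.2 *: x.
rewrite (_ : point_join K x = f @` (K `*` `[0, 1]%classic)).
  apply: continuous_compact; last first.
    by apply: compact_setX => //; exact: segment_compact.
  apply: continuous_subspaceT => p; apply: cvgD.
    apply: cvgZ; last exact: cvg_fst.
    by apply: cvgB; [exact: cvg_cst|exact: cvg_snd].
  by apply: cvgZ; [exact: cvg_snd|exact: cvg_cst].
apply/seteqP; split => y.
  move=> [k [t [Kk t0 t1 ->]]]; exists (k, t) => //.
  by split => //=; rewrite in_itv/= t0 t1.
by move=> [[k t] [/= Kk]]; rewrite in_itv/= => /andP[t0 t1] <-; exists k, t.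
Qed.

Section ConvexHull.
Context {R : realType} {n : nat}.
Implicit Types K C : set 'rV[R]_n.

Lemma conv_setU1 K x : convex_set K -> K !=set0 ->
  Defs.conv (K `|` [set x]) = point_join K x.
Proof.
move=> cK K0; apply/seteqP; split => y.
  move=> hull_y; apply: hull_y (convex_point_join cK) _ => z [|->].
    exact: sub_point_join.
  exact: point_join_apex.
move=> [k [t [Kk t0 t1 ->]]] C /convex_setP cC KC.
by apply: cC => //; apply: KC; [left|right].
Qed.

Definition affine_map (f : 'rV[R]_n -> 'rV[R]_n) :=
  forall x y t, f ((1 - t) *: x + t *: y) = (1 - t) *: f x + t *: f y.

Lemma affine_map_inv f g : affine_map f -> cancel f g -> cancel g f ->
  affine_map g.
Proof.
by move=> affine_f fK gK x y t; apply: (can_inj fK); rewrite affine_f !gK.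
Qed.

Lemma affine_map_mulmx (A : 'M[R]_n) a : affine_map (fun x => (x + a) *m A).
Proof.
move=> x y t; rewrite !scalemxAl -mulmxDl; congr (_ *m _).
by rewrite !scalerDr addrACA -scalerDl subrK scale1r.
Qed.

Lemma convex_preimage f C : affine_map f -> convex_set C ->
  convex_set (f @^-1` C).
Proof.
move=> affine_f /convex_setP cC; apply/convex_setP => x y t t0 t1 Cx Cy.
by rewrite /preimage/= affine_f; exact: cC.
Qed.

Lemma conv_preimage f g C : affine_map f -> cancel f g -> cancel g f ->
  Defs.conv (f @^-1` C) = f @^-1` Defs.conv C.
Proof.
move=> affine_f fK gK; apply/seteqP; split => x hull_x D cD CD.
  by apply: (hull_x (f @^-1` D) (convex_preimage affine_f cD)) => y; exact: CD.
have affine_g := affine_map_inv affine_f fK gK.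
rewrite -(fK x).
apply: (hull_x (g @^-1` D) (convex_preimage affine_g cD)) => y Cy.
by apply: CD; rewrite /preimage/= gK.
Qed.

Lemma illumination_preimage f g K x : affine_map f -> cancel f g ->
  cancel g f ->
  illumination x (f @^-1` K) = vol (f @^-1` Defs.conv (K `|` [set f x])).
Proof.
move=> affine_f fK gK; rewrite /illumination -(conv_preimage _ affine_f fK gK).
congr (vol (Defs.conv (_ `|` _))); apply/seteqP.
by split => y /=; [move=> ->|exact: (can_inj fK)].
Qed.

End ConvexHull.

Section ConvexContinuous.
Context {R : realType} {V : normedModType R}.
Variable f : V -> R.
Hypothesis f_convex : convex_function [set: convex_lmodType V] f.
Implicit Types x h z : V.

Lemma convex_increment_le x h (r B : R) : 0 < r ->
  (forall z, `|z| = r -> f (x + z) <= B) -> `|h| <= r ->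
  f (x + h) - f x <= `|h| / r * (B - f x).
Proof.
move=> r0 sphereB hr; have [->|h0] := eqVneq h 0.
  by rewrite addr0 subrr normr0 !mul0r.
pose t := `|h| / r; have t0 : 0 < t by rewrite divr_gt0// normr_gt0.
have t1 : t <= 1 by rewrite ler_pdivrMr// mul1r.
have tN0 : t != 0 by rewrite gt_eqF.
have zr : `|t^-1 *: h| = r.
  by rewrite normrZ gtr0_norm ?invr_gt0// /t invf_div mulfVK ?normr_eq0.
have := (proj1 (convex_functionP f) f_convex) x (x + t^-1 *: h) t (ltW t0) t1.
rewrite scalerDr scalerA divff// scale1r addrA -scalerDl subrK scale1r.
have := ler_wpM2l (ltW t0) (sphereB _ zr); rewrite -/t; lra.
Qed.

Lemma convex_decrement_le x h : f x - f (x + h) <= f (x - h) - f x.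
Proof.
have [half0 half1] : 0 <= 2^-1 :> R /\ 2^-1 <= 1 :> R by split; lra.
have := (proj1 (convex_functionP f) f_convex) (x + h) (x - h) _ half0 half1.
have -> : 1 - 2^-1 = 2^-1 :> R by lra.
rewrite -scalerDr addrACA subrr addr0 scalerDr -scalerDl.
have -> : 2^-1 + 2^-1 = 1 :> R by lra.
rewrite scale1r; lra.
Qed.

Lemma convex_bounded_above_continuous x :
  (exists B, \forall y \near x, f y <= B) -> {for x, continuous f}.
Proof.
move=> [B /nbhs_normP[r0 /= r0_gt0 ballB]]; pose r := r0 / 2.
have r_gt0 : 0 < r by rewrite divr_gt0.
have sphereB z : `|z| = r -> f (x + z) <= B.
  move=> zr; apply: ballB; rewrite /= opprD addrA subrr sub0r normrN zr.
  by rewrite ltr_pdivrMr// ltr_pMr// ltr1n.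
have lipschitz h : `|h| <= r -> `|f x - f (x + h)| <= `|h| * ((B - f x) / r).
  move=> hr; rewrite mulrCA mulrC ler_norml -lerNl opprB.
  rewrite (convex_increment_le r_gt0 sphereB hr)/=.
  apply: le_trans (convex_decrement_le x h) _; rewrite -(normrN h).
  by apply: convex_increment_le r_gt0 sphereB _; rewrite normrN.
apply/cvgrPdist_le => e e0; near=> y.
have -> : y = x + (y - x) by rewrite addrC subrK.
apply: le_trans (lipschitz _ _) _.
  by near: y; apply: cvgr_distC_le; [exact: cvg_id|exact: r_gt0].
near: y.
have : (fun y => `|y - x| * ((B - f x) / r)) @ x --> `|x - x| * ((B - f x) / r).
  apply: cvgM; last exact: cvg_cst.
  by apply: cvg_norm; apply: cvgB; [exact: cvg_id|exact: cvg_cst].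
rewrite subrr normr0 mul0r => /cvgrPdist_le/(_ _ e0); apply: filterS => y.
by rewrite sub0r normrN; exact: le_trans (ler_norm _).
Unshelve. all: by end_near.
Qed.

End ConvexContinuous.

Section IntervalLength.
Context {R : realType}.
Implicit Types A B C : set R.
Local Open Scope ereal_scope.

Lemma lebesgue_measure_le_diam A (D : \bar R) :
  measurable A -> 0 <= D ->
  (forall p q, A p -> A q -> (q - p)%:E <= D) -> lebesgue_measure A <= D.
Proof.
move=> mA D0 AD.
have [->|/set0P[a Aa]] := eqVneq A set0; first by rewrite measure0.
case: D D0 AD => [D|_ _|//]; last by rewrite leey.
rewrite lee_fin => D0 AD.
have {}AD p q : A p -> A q -> (q <= p + D)%R.
  by move=> Ap Aq; have := AD p q Ap Aq; rewrite lee_fin lerBlDl.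
have A0 : A !=set0 by exists a.
have ubA : has_ubound A by exists (a + D)%R => q; exact: AD.
have lbA : has_lbound A by exists (a - D)%R => p Ap; rewrite lerBlDr; exact: AD.
have subA : A `<=` `[inf A, sup A]%classic.
  by move=> p Ap; rewrite /= in_itv/= ge_inf// ub_le_sup.
apply: (@le_trans _ _ (lebesgue_measure `[inf A, sup A]%classic)).
  by apply: le_measure => //; rewrite inE.
rewrite lebesgue_measure_itv/= lte_fin; case: ifP => // _.
rewrite -EFinB lee_fin lerBlDl -lerBlDr; apply: lb_le_inf => // p Ap.
by rewrite lerBlDr; apply: ge_sup => // q Aq; exact: AD.
Qed.

Lemma diam_le_lebesgue_measure A a b : is_interval A -> A a -> A b ->
  (b - a)%:E <= lebesgue_measure A.
Proof.
move=> iA Aa Ab; have [ab|ba] := leP a b; last first.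
  by apply: (@le_trans _ _ 0) => //; rewrite lee_fin subr_le0 ltW.
have : lebesgue_measure `[a, b]%classic <= lebesgue_measure A.
  apply: le_measure; rewrite ?inE//; first exact: is_interval_measurable.
  by move=> t /=; rewrite in_itv/=; exact: iA.
apply: le_trans; rewrite lebesgue_measure_itv/= lte_fin -EFinB.
by case: ltrP => // ba; rewrite lee_fin subr_le0.
Qed.

Lemma lebesgue_measure_le_conv A B C l : (0 <= l <= 1)%R ->
  is_interval A -> is_interval B -> measurable C ->
  (forall r, C r -> exists a b, [/\ A a, B b & r = (1 - l) * a + l * b]%R) ->
  lebesgue_measure C <=
    (1 - l)%:E * lebesgue_measure A + l%:E * lebesgue_measure B.
Proof.
move=> /andP[l0 l1] iA iB mC CAB.
have onem_l_ge0 : (0 <= 1 - l)%R by rewrite subr_ge0.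
apply: lebesgue_measure_le_diam => //; first by rewrite adde_ge0// mule_ge0.
move=> p q /CAB[a [b [Aa Bb ->]]] /CAB[a' [b' [Aa' Bb' ->]]].
rewrite (_ : (_ - _)%R = ((1 - l) * (a' - a) + l * (b' - b))%R); last by ring.
rewrite EFinD !EFinM; apply: leeD; apply: lee_wpmul2l; rewrite ?lee_fin//.
- exact: diam_le_lebesgue_measure.
- exact: diam_le_lebesgue_measure.
Qed.

End IntervalLength.

Section ParallelLines.
Context {R : realType} {n : nat}.
Implicit Types (E : set 'rV[R]_n.+1) (v : 'rV[R]_n) (u : 'rV[R]_n.+1).

Lemma volume_fibre E : borel E ->
  [/\ forall v, measurable (row_cons ^~ v @^-1` E),
      borel_fun (fun v => lebesgue_measure (row_cons ^~ v @^-1` E)) &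
      volume n.+1 E =
        (\int[volume n]_v lebesgue_measure (row_cons ^~ v @^-1` E))%E].
Proof.
move=> mE; pose uncurried : measurableTypeR R * Borel_Rd R n -> 'rV[R]_n.+1 :=
  fun p => row_cons p.1 p.2.
pose rcE := uncurried @^-1` E.
have mrcE : measurable rcE.
  by rewrite -[X in measurable X]setTI; exact: measurable_row_cons.
have sectionE v : ysection rcE v = row_cons ^~ v @^-1` E.
  by apply/seteqP; split=> t /=; rewrite /ysection/= inE.
split=> [v||].
- by rewrite -sectionE; exact: measurable_ysection.
- under eq_fun do rewrite -sectionE.
  exact: measurable_fun_ysection.
rewrite (volume_integral_indic mE) integral_volumeS//;
  last exact/measurable_EFinP.
have mindic : measurable_fun setT (EFin \o \1_rcE : _ -> \bar R).
  exact/measurable_EFinP.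
have swap := @fubini_tonelli _ _ _ _ R lebesgue_measure (volume n) _ mindic.
apply: etrans (swap _) _.
  by move=> p; rewrite lee_fin.
apply: eq_integral => v _.
have mfibre : measurable (row_cons ^~ v @^-1` E).
  by rewrite -sectionE; exact: measurable_ysection.
by have := @integral_indic _ _ R lebesgue_measure setT measurableT _ mfibre;
  rewrite setIT.
Qed.

Lemma unitmx_row0 u : u != 0 ->
  exists2 A : 'M[R]_n.+1, A \in unitmx & row 0 A = u.
Proof.
move=> u0; pose C := \matrix_(i < n.+1) u.
have e0C : delta_mx 0 0 *m C = u :> 'rV_n.+1 by rewrite -rowE rowK.
have [|A uA e0A] := @complete_unitmx _ 1 n.+1 (delta_mx 0 0) C.
  by rewrite e0C rank_rV u0 mxrank_delta.
by exists A; rewrite // rowE -e0A.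
Qed.

Lemma mulmx_row_consD (A : 'M[R]_n.+1) v t r :
  row_cons (t + r) v *m A = row_cons t v *m A + r *: row 0 A.
Proof.
rewrite -[v in LHS]addr0 row_consD mulmxDl rowE scalemxAl; congr (_ + _ *m _).
apply/rowP => i; rewrite [RHS]mxE [X in _ * X]mxE.
case: (unliftP ord0 i) => [j|] ->.
  by rewrite row_cons_tail mxE mulr0.
by rewrite row_cons_head eqxx mulr1.
Qed.

(* Tonelli's theorem in linear coordinates whose first axis is along [u]. *)
Lemma volume_parallel_lines u : u != 0 ->
  exists line : 'rV[R]_n -> R -> 'rV[R]_n.+1, exists c : R,
  [/\ 0 < c, forall v t r, line v (t + r) = line v t + r *: u &
    forall E, borel E ->
    [/\ forall v, measurable (line v @^-1` E),
        borel_fun (fun v => lebesgue_measure (line v @^-1` E)) &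
        (c%:E * volume n.+1 E =
         \int[volume n]_v lebesgue_measure (line v @^-1` E))%E]].
Proof.
move=> /unitmx_row0[A uA Au]; have [c c0 scale] := volume_mulmx uA.
exists (fun v t => row_cons t v *m A), c; split => // [v t r|E mE].
  by rewrite mulmx_row_consD Au.
have [mfibre mlength volA] := volume_fibre (borel_preimage_mulmxr A mE).
by split; [exact: mfibre|exact: mlength|rewrite -scale].
Qed.

Lemma is_interval_line (line : R -> 'rV[R]_n.+1) u E :
  (forall t r, line (t + r) = line t + r *: u) -> convex_set E ->
  is_interval (line @^-1` E).
Proof.
move=> lineD /convex_setP cE; apply/is_intervalPlt => a b Ea Eb m /andP[am mb].
have ab : 0 < b - a by rewrite subr_gt0 (lt_trans am).
have line_a r : line r = line a + (r - a) *: u by rewrite -lineD addrC subrK.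
pose t := (m - a) / (b - a).
rewrite /preimage/= (_ : line m = (1 - t) *: line a + t *: line b).
  apply: cE => //; first by apply: divr_ge0; [rewrite subr_ge0|]; exact: ltW.
  by rewrite ler_pdivrMr// mul1r lerD2r ltW.
rewrite (line_a b) scalerDr addrA -scalerDl subrK scale1r scalerA.
by rewrite divfK ?gt_eqF.
Qed.

End ParallelLines.

(* [E0], [E] and [E1] are three positions of a shadow system: each chord of [E]
   parallel to [u] is covered by the convex combination of the chords of [E0]
   and [E1] on the same line. *)
Lemma volume_shadow_le {R : realType} {n : nat} (u : 'rV[R]_n)
    (E E0 E1 : set 'rV[R]_n) l :
  u != 0 -> 0 <= l <= 1 -> borel E -> borel E0 -> borel E1 ->
  convex_set E0 -> convex_set E1 ->
  (forall p, E p ->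
     exists s, E0 (p - (s * l) *: u) /\ E1 (p + (s * (1 - l)) *: u)) ->
  (volume n E <= (1 - l)%:E * volume n E0 + l%:E * volume n E1)%E.
Proof.
case: n u E E0 E1 => [|n] u E E0 E1 u0 l01 mE mE0 mE1 cE0 cE1 shadow.
  by rewrite [u]thinmx0 eqxx in u0.
have /andP[l0 l1] := l01.
have [line [c [c0 lineD parallel]]] := volume_parallel_lines u0.
have [mC mlength volC] := parallel _ mE.
have [mC0 mlength0 volC0] := parallel _ mE0.
have [mC1 mlength1 volC1] := parallel _ mE1.
have chord_le v : (lebesgue_measure (line v @^-1` E) <=
    (1 - l)%:E * lebesgue_measure (line v @^-1` E0) +
    l%:E * lebesgue_measure (line v @^-1` E1))%E.
  apply: lebesgue_measure_le_conv => //.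
  - exact: is_interval_line (lineD v) cE0.
  - exact: is_interval_line (lineD v) cE1.
  move=> r /shadow[s [E0r E1r]]; exists (r - s * l), (r + s * (1 - l)); split.
  - by rewrite /preimage/= lineD scaleNr.
  - by rewrite /preimage/= lineD.
  - by ring.
rewrite -(@lee_pmul2l _ c%:E)// ge0_muleDr ?mule_ge0 ?lee_fin ?subr_ge0//.
rewrite !(muleCA c%:E) volC volC0 volC1 -!ge0_integralZl ?lee_fin ?subr_ge0//.
rewrite -ge0_integralD//; last 4 first.
- by move=> v _; rewrite mule_ge0// lee_fin subr_ge0.
- exact: measurable_funeM.
- by move=> v _; rewrite mule_ge0// lee_fin.
- exact: measurable_funeM.
apply: ge0_le_integral => //.
by apply: emeasurable_funD; exact: measurable_funeM.
Qed.

Section IlluminationVolume.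
Context {R : realType} {n : nat}.
Implicit Types (K : set 'rV[R]_n) (x y p : 'rV[R]_n).

Definition illum_vol K x : R := fine (volume n (point_join K x)).

Lemma volume_compact_fin K : compact K -> volume n K \is a fin_num.
Proof.
move=> cK; have [M M0 KM] := compact_sub_cball cK.
rewrite ge0_fin_numE//; apply: (@le_lt_trans _ _ (volume n (cball M))).
  by apply: le_measure => //; rewrite inE;
    [exact: compact_borel|exact: borel_cball].
by rewrite volume_cball ?ltry// ltW.
Qed.

(* Moving the apex along [y - x], the chords of the hull move along with it. *)
Lemma point_join_shadow K x y l p : point_join K ((1 - l) *: x + l *: y) p ->
  exists s, point_join K x (p - (s * l) *: (y - x)) /\
            point_join K y (p + (s * (1 - l)) *: (y - x)).
Proof.
move=> [k [s [Kk s0 s1 ->]]]; exists s; split; exists k, s; split => //.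
  by apply/rowP => i; rewrite !mxE; ring.
by apply/rowP => i; rewrite !mxE; ring.
Qed.

Context {K : set 'rV[R]_n}.
Hypotheses (K_compact : compact K) (K_convex : convex_set K).

Lemma borel_point_join x : borel (point_join K x).
Proof. by apply: compact_borel; exact: compact_point_join. Qed.

Lemma volume_point_join x : volume n (point_join K x) = (illum_vol K x)%:E.
Proof.
by rewrite fineK//; apply: volume_compact_fin; exact: compact_point_join.
Qed.

Lemma illuminationE x : K !=set0 -> illumination x K = (illum_vol K x)%:E.
Proof.
by move=> K0; rewrite /illumination conv_setU1// volE ?volume_point_join//;
  exact: borel_point_join.
Qed.

Lemma volume_compact : volume n K = (fine (volume n K))%:E.
Proof. by rewrite fineK// volume_compact_fin. Qed.

Lemma illum_vol_ge x : fine (volume n K) <= illum_vol K x.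
Proof.
rewrite -lee_fin -volume_point_join -volume_compact.
apply: le_measure; rewrite ?inE.
- exact: compact_borel.
- exact: borel_point_join.
- exact: sub_point_join.
Qed.

Lemma illum_vol_id x : K x -> illum_vol K x = fine (volume n K).
Proof. by move=> Kx; rewrite /illum_vol point_join_id. Qed.

End IlluminationVolume.

Lemma illum_vol_convex {R : realType} {n : nat} {K : set 'rV[R]_n} :
  compact K -> convex_set K ->
  convex_function [set: convex_lmodType 'rV[R]_n] (illum_vol K).
Proof.
move=> K_compact K_convex; apply/convex_functionP => x y l l0 l1.
have [->|xy] := eqVneq x y.
  by rewrite -scalerDl -mulrDl subrK scale1r mul1r.
rewrite -lee_fin EFinD !EFinM -!volume_point_join//.
apply: (@volume_shadow_le _ _ (y - x)); rewrite ?l0//.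
- by rewrite subr_eq0 eq_sym.
- exact: borel_point_join.
- exact: borel_point_join.
- exact: borel_point_join.
- exact: convex_point_join.
- exact: convex_point_join.
- exact: point_join_shadow.
Qed.

Section IlluminationGrowth.
Context {R : realType} {n : nat} {K : set 'rV[R]_n}.
Hypotheses (K_compact : compact K) (K_convex : convex_set K).
Implicit Types x y : 'rV[R]_n.

Lemma illum_vol_le_volume_cball M x : K `<=` cball M -> `|x| <= M ->
  illum_vol K x <= fine (volume n (cball M)).
Proof.
move=> KM xM; have M0 : 0 <= M by exact: le_trans (normr_ge0 x) xM.
rewrite -lee_fin -volume_point_join// fineK ?volume_cball// -volume_cball//.
apply: le_measure; rewrite ?inE; [exact: borel_point_join|exact: borel_cball|].
move=> _ [k [t [Kk t0 t1 ->]]]; rewrite /cball/=.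
apply: le_trans (ler_normD _ _) _; rewrite !normrZ !ger0_norm ?subr_ge0//.
by have := KM _ Kk; rewrite /cball/=; nra.
Qed.

Lemma illum_vol_continuous : continuous (illum_vol K).
Proof.
move=> x; apply: convex_bounded_above_continuous; first exact: illum_vol_convex.
have [M M0 KM] := compact_sub_cball K_compact; pose N := Num.max M (`|x| + 1).
exists (fine (volume n (cball N))); near=> y; apply: illum_vol_le_volume_cball.
  by move=> k /KM/le_trans; apply; rewrite le_max lexx.
rewrite le_max; apply/orP; right; rewrite -[y](subrK x).
apply: le_trans (ler_normD _ _) _; rewrite addrC lerD2l.
by near: y; apply: cvgr_distC_le; [exact: cvg_id|exact: ltr01].
Unshelve. all: by end_near.
Qed.

(* [K] and its homothetic copy [(K + y) / 2] are disjoint parts of the hull once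
   [y] is far. *)
Lemma illum_vol_gain : exists2 c : R, 0 < c &
  exists D, forall y, D <= `|y| -> (1 + c) * fine (volume n K) <= illum_vol K y.
Proof.
have two_unit : (2%:M : 'M[R]_n) \in unitmx.
  by rewrite unitmxE det_scalar unitrX// unitfE pnatr_eq0.
have [c c0 scale] := volume_affine two_unit; exists c => //.
have [M M0 KM] := compact_sub_cball K_compact; exists (4 * M) => y yM.
pose copy := (fun w => (w + - (2^-1 *: y)) *m 2%:M) @^-1` K.
have copyE w : (w + - (2^-1 *: y)) *m 2%:M = 2 *: w - y.
  by rewrite mul_mx_scalar scalerDr scalerN scalerA divff ?scale1r ?pnatr_eq0.
have mK := compact_borel K_compact.
have mcopy : borel copy := borel_preimage_shift _ (borel_preimage_mulmxr _ mK).
have disjoint : K `&` copy = set0.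
  apply/seteqP; split => // w [Kw]; rewrite /copy/preimage/= copyE => /KM yw.
  have := KM _ Kw; rewrite /cball/= => wM.
  have : `|y| <= `|2 *: w| + `|2 *: w - y|.
    by rewrite -[in leLHS](subKr (2 *: w) y) ler_normB.
  by rewrite normrZ ger0_norm//; move: yw; rewrite /cball/=; lra.
rewrite -lee_fin -volume_point_join// mulrDl mul1r EFinD EFinM.
rewrite -volume_compact// -(scale (- (2^-1 *: y)) _ mK).
rewrite -measureU//; apply: le_measure; rewrite ?inE.
- exact: measurableU.
- exact: borel_point_join.
move=> w [Kw|]; first exact: sub_point_join.
rewrite /copy/preimage/= copyE => Kw; exists (2 *: w - y), 2^-1.
split=> //; first lra.
by apply/rowP => i; rewrite !mxE; field.
Qed.

Lemma illum_vol_diverges k : K k -> 0 < fine (volume n K) ->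
  forall A, exists D, forall y, D <= `|y| -> A <= illum_vol K y.
Proof.
move=> Kk; set v := fine _ => v0 A; have [c c0 [D gain]] := illum_vol_gain.
pose r := `|D| + `|k| + 1; have r0 : 0 < r by rewrite ltr_wpDl.
exists (`|k| + Num.max r (A * r / (c * v))) => y; rewrite addrC -lerBrDr => yk.
have {yk} : Num.max r (A * r / (c * v)) <= `|y - k|.
  exact: le_trans yk (lerB_dist _ _).
rewrite ge_max => /andP[ry]; rewrite ler_pdivrMr ?mulr_gt0// => Ay.
have yk0 : 0 < `|y - k| by exact: lt_le_trans ry.
pose t := r / `|y - k|; have t0 : 0 < t by rewrite divr_gt0.
have t1 : t <= 1 by rewrite ler_pdivrMr// mul1r.
have : (1 + c) * v <= (1 - t) * v + t * illum_vol K y.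
  rewrite -[v in (1 - t) * v](illum_vol_id K_convex Kk).
  have /convex_functionP cill := illum_vol_convex K_compact K_convex.
  apply: le_trans (cill _ _ _ (ltW t0) t1); apply: gain.
  have -> : (1 - t) *: k + t *: y = k + t *: (y - k).
    by rewrite scalerBl scale1r scalerBr addrA addrAC.
  rewrite addrC; apply: le_trans (lerB_normD _ _).
  rewrite normrZ gtr0_norm// divfK ?gt_eqF// /r.
  by rewrite addrAC addrK; apply: le_trans (ler_norm _) _; rewrite lerDl.
have -> : (1 + c) * v = v + c * v by ring.
have tyk : t * `|y - k| = r by rewrite divfK ?gt_eqF.
move=> gain_y; have cv : c * v <= t * illum_vol K y by nra.
rewrite -(ler_pM2l r0) mulrC; apply: le_trans Ay _.
by rewrite -tyk mulrAC [leLHS]mulrC ler_pM2r.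
Qed.

End IlluminationGrowth.

Section DotProduct.
Context {R : realType} {n : nat}.
Implicit Types u x y : 'rV[R]_n.

Lemma dotvE u x : dotv u x = (u *m x^T) ord0 ord0.
Proof. by rewrite mxE; apply: eq_bigr => i _; rewrite mxE. Qed.

Lemma dotvC u x : dotv u x = dotv x u.
Proof. by apply: eq_bigr => i _; rewrite mulrC. Qed.

Lemma dotvDr u x y : dotv u (x + y) = dotv u x + dotv u y.
Proof. by rewrite !dotvE linearD mulmxDr mxE. Qed.

Lemma dotvZr u t x : dotv u (t *: x) = t * dotv u x.
Proof. by rewrite !dotvE linearZ -scalemxAr mxE. Qed.

Lemma dotvZl u t x : dotv (t *: u) x = t * dotv u x.
Proof. by rewrite dotvC dotvZr dotvC. Qed.

Lemma dotvNl u x : dotv (- u) x = - dotv u x.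
Proof. by rewrite -scaleN1r dotvZl mulN1r. Qed.

Lemma dot0v x : dotv 0 x = 0.
Proof. by rewrite -(scale0r 0) dotvZl mul0r. Qed.

Lemma dotv_mulmx u x (A : 'M[R]_n) : dotv u (x *m A^T) = dotv (u *m A) x.
Proof. by rewrite !dotvE trmx_mul trmxK mulmxA. Qed.

Lemma dotv_ge0 x : 0 <= dotv x x.
Proof. by apply: sumr_ge0 => i _; rewrite -expr2 sqr_ge0. Qed.

Lemma sqr_coord_le x i : x ord0 i ^+ 2 <= dotv x x.
Proof.
rewrite /dotv (bigD1 i)//= -expr2 lerDl.
by apply: sumr_ge0 => j _; rewrite -expr2 sqr_ge0.
Qed.

Lemma normr_le_enorm x : `|x| <= enorm x.
Proof.
apply/rV_norm_le => [|i]; first exact: sqrtr_ge0.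
by rewrite -sqrtr_sqr ler_wsqrtr// sqr_coord_le.
Qed.

Lemma enorm_le_normr x : enorm x <= Num.sqrt n%:R * `|x|.
Proof.
have dotv_le : dotv x x <= n%:R * `|x| ^+ 2.
  rewrite mulr_natl -[X in _ *+ X]card_ord -sumr_const; apply: ler_sum => i _.
  by rewrite -expr2 -real_normK ?num_real// ler_pXn2r ?nnegrE// normr_coord.
by apply: le_trans (ler_wsqrtr dotv_le) _; rewrite sqrtrM// sqrtr_sqr normr_id.
Qed.

Lemma dotv_eq0 x : (dotv x x == 0) = (x == 0).
Proof.
apply/eqP/eqP => [x0|->]; last exact: dot0v.
have := normr_le_enorm x; rewrite /enorm x0 sqrtr0.
by rewrite normr_le0 => /eqP.
Qed.

Lemma cvg_dotv (T : Type) (F : set_system T) {FF : Filter F}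
    (f g : T -> 'rV[R]_n) u x :
  f @ F --> u -> g @ F --> x -> dotv (f t) (g t) @[t --> F] --> dotv u x.
Proof.
move=> fu gx; apply: cvg_big => [|i _]; first exact: add_continuous.
have cvg_coord h (y : 'rV[R]_n) : h @ F --> y ->
    h t ord0 i @[t --> F] --> y ord0 i.
  by move=> hy; exact: cvg_comp hy (@coord_continuous R 1 n ord0 i y).
by apply: cvgM; exact: cvg_coord.
Qed.

Lemma dotv_continuous u : continuous (dotv u).
Proof.
by move=> x; apply: (@cvg_dotv _ (nbhs x) _ (fun=> u) id u x (cvg_cst u));
  exact: cvg_id.
Qed.

Lemma enorm_continuous : continuous (@enorm R n).
Proof.
move=> x; apply: (@cvg_comp _ _ _ (fun y => dotv y y) Num.sqrt).
  by apply: (@cvg_dotv _ (nbhs x) _ id id x x); exact: cvg_id.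
exact: sqrt_continuous.
Qed.

Lemma unit_sphere_compact : compact [set u : 'rV[R]_n | `|u| = 1].
Proof.
apply: (@closed_sub_cball_compact _ _ _ 1) => [|u].
  by apply: closed_level => u; exact: norm_continuous.
by rewrite /cball/= => ->.
Qed.

Definition halfspace u (c : R) : set 'rV[R]_n := [set y | dotv u y <= c].

Definition open_halfspace u (c : R) : set 'rV[R]_n := [set y | dotv u y < c].

Lemma closed_halfspace u c : closed (halfspace u c).
Proof. by apply: closed_sublevel; exact: dotv_continuous. Qed.

Lemma borel_halfspace u c : borel (halfspace u c).
Proof. by apply: closed_borel; exact: closed_halfspace. Qed.

Lemma borel_hyperplane u c : borel [set y | dotv u y = c].
Proof. by apply: closed_borel; apply: closed_level; exact: dotv_continuous. Qed.

Lemma open_open_halfspace u c : open (open_halfspace u c).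
Proof. by apply: open_strict_sublevel; exact: dotv_continuous. Qed.

Lemma halfspace0 c : 0 <= c -> halfspace 0 c = setT.
Proof.
by move=> c0; apply/seteqP; split => // y _; rewrite /halfspace/= dot0v.
Qed.

Lemma halfspaceZ u t c : 0 < t -> halfspace (t *: u) (t * c) = halfspace u c.
Proof.
by move=> t0; apply/funext => y; rewrite /halfspace/= dotvZl ler_pM2l.
Qed.

Lemma halfspaceS u a b : a <= b -> halfspace u a `<=` halfspace u b.
Proof. by move=> ab y /= /le_trans; exact. Qed.

Lemma bigcap_halfspace u c :
  \bigcap_k halfspace u (c + k.+1%:R^-1) = halfspace u c.
Proof.
apply/seteqP; split => y /= yc; last first.
  by move=> k _; apply: halfspaceS yc; rewrite lerDl.
apply/ler_addgt0Pr => e e0; have /ltr_add_invr[k] := e0; rewrite add0r => ke.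
by apply: le_trans (yc k I) _; rewrite lerD2l ltW.
Qed.

End DotProduct.

Section MeasureContinuity.
Context d (T : measurableType d) (R : realType).
Variables (mu : {measure set T -> \bar R}) (F : (set T)^nat) (a : \bar R).
Hypothesis mF : forall k, measurable (F k).
Local Open Scope ereal_scope.

Lemma measure_bigcap_lt : mu (F 0%N) < +oo -> nonincreasing_seq F ->
  mu (\bigcap_k F k) < a -> exists k, mu (F k) < a.
Proof.
move=> F0 ndF Fa; have cvgF : mu \o F @ \oo --> mu (\bigcap_k F k).
  by apply: nonincreasing_cvg_mu => //; exact: bigcapT_measurable.
have : \forall k \near \oo, mu (F k) < a.
  apply: (cvgF [set z | z < a]); apply: open_nbhs_nbhs; split => //.
  exact: open_ereal_lt_ereal.
by move=> [N _ /(_ N (leqnn N))]; exists N.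
Qed.

Lemma measure_bigcup_gt : nondecreasing_seq F ->
  a < mu (\bigcup_k F k) -> exists k, a < mu (F k).
Proof.
move=> ndF Fa; have cvgF : mu \o F @ \oo --> mu (\bigcup_k F k).
  by apply: nondecreasing_cvg_mu => //; exact: bigcupT_measurable.
have : \forall k \near \oo, a < mu (F k).
  apply: (cvgF [set z | a < z]); apply: open_nbhs_nbhs; split => //.
  exact: open_ereal_gt_ereal.
by move=> [N _ /(_ N (leqnn N))]; exists N.
Qed.

End MeasureContinuity.

Section Depth.
Context {R : realType} {n : nat} (P : probability (Borel_Rd R n) R).
Implicit Types u x y : 'rV[R]_n.
Local Notation HD := (halfspace_depth (probfun P)).

Lemma depthE x : (HD x)%:E =
  ereal_inf [set P (halfspace u (dotv u x)) | u in [set: 'rV[R]_n]].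
Proof.
rewrite fineK// ge0_fin_numE; last first.
  by apply: le_ereal_inf_tmp => _ [u _ <-]; exact: measure_ge0.
apply: (@le_lt_trans _ _ 1%E); last exact: ltry.
apply: ereal_inf_lbound; exists 0 => //.
by rewrite -/(halfspace 0 _) dot0v halfspace0//; exact: probability_setT.
Qed.

Lemma depth_geP a x : a <= HD x <->
  forall u, (a%:E <= P (halfspace u (dotv u x)))%E.
Proof.
rewrite -lee_fin depthE; split => [ax u|au]; last first.
  by apply: le_ereal_inf_tmp => _ [u _ <-].
by apply: le_trans ax _; apply: ereal_inf_lbound; exists u.
Qed.

Lemma depth_le_halfspace x u : ((HD x)%:E <= P (halfspace u (dotv u x)))%E.
Proof. exact: (proj1 (depth_geP _ _)). Qed.

Lemma depth_ltP a x : HD x < a <->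
  exists u, (P (halfspace u (dotv u x)) < a%:E)%E.
Proof.
rewrite -lte_fin; split => [|[u]]; last exact/le_lt_trans/depth_le_halfspace.
by rewrite depthE => /ereal_inf_lt[_ [u _ <-] ua]; exists u.
Qed.

Lemma depth_ge0 x : 0 <= HD x.
Proof. by apply/depth_geP => u; exact: measure_ge0. Qed.

Lemma depth_le1 x : HD x <= 1.
Proof.
rewrite -lee_fin; apply: le_trans (depth_le_halfspace x 0) _.
by apply: probability_le1; exact: borel_halfspace.
Qed.

Lemma prob_halfspace_le u a b : a <= b ->
  (P (halfspace u a) <= P (halfspace u b))%E.
Proof.
move=> ab; apply: le_measure; rewrite ?inE; [exact: borel_halfspace..|].
exact: halfspaceS.
Qed.

Lemma depth_ge_unit_directions a x : a <= 1 ->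
  (forall u, `|u| = 1 -> (a%:E <= P (halfspace u (dotv u x)))%E) -> a <= HD x.
Proof.
move=> a1 unit_dirs; apply/depth_geP => u; have [->|u0] := eqVneq u 0.
  by rewrite dot0v halfspace0// probability_setT lee_fin.
have u_gt0 : 0 < `|u|^-1 by rewrite invr_gt0 normr_gt0.
have := unit_dirs (`|u|^-1 *: u); rewrite dotvZl halfspaceZ//; apply.
by rewrite normrZ gtr0_norm// mulVf ?normr_eq0.
Qed.

Lemma convex_central_region a : convex_set (central_region (probfun P) a).
Proof.
apply/convex_setP => x y t t0 t1 /depth_geP ax /depth_geP ay.
apply/depth_geP => u.
rewrite dotvDr !dotvZr; have [xy|yx] := leP (dotv u x) (dotv u y).
  by apply: le_trans (ax u) (prob_halfspace_le _ _); nra.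
by apply: le_trans (ay u) (prob_halfspace_le _ _); nra.
Qed.

Lemma depth_upper_semicontinuous : upper_semicontinuous HD.
Proof.
move=> x a /depth_ltP[u].
rewrite -bigcap_halfspace => /measure_bigcap_lt[k||i j ij|k Pk].
- exact: borel_halfspace.
- apply: le_lt_trans (ltry 1); apply: probability_le1.
  exact: borel_halfspace.
- by apply/subsetPset/halfspaceS; rewrite lerD2l lef_pV2 ?posrE// ler_nat.
exists (open_halfspace u (dotv u x + k.+1%:R^-1)).
  apply: open_nbhs_nbhs; split; first exact: open_open_halfspace.
  by rewrite /open_halfspace/= ltrDl.
move=> y /ltW yx; apply/depth_ltP; exists u.
exact: le_lt_trans (prob_halfspace_le u yx) Pk.
Qed.

(* [x.y >= x.x] forces [|y| >= |x|], as [2 x.y <= x.x + y.y]. *)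
Lemma depth_le_tail x : ((HD x)%:E <= P [set y | (enorm x <= enorm y)%R])%E.
Proof.
apply: le_trans (depth_le_halfspace x (- x)) _; apply: le_measure; rewrite ?inE.
- exact: borel_halfspace.
- by apply: closed_borel; apply: closed_superlevel; exact: enorm_continuous.
move=> y; rewrite /halfspace/= !dotvNl lerN2 => xy; apply: ler_wsqrtr.
have := dotv_ge0 (x - y); rewrite -scaleN1r dotvDr dotvZr !(dotvC (x + _)).
by rewrite !dotvDr !dotvZr (dotvC y x); lra.
Qed.

Lemma depth_vanishes e : 0 < e -> exists M, forall x, M <= enorm x -> HD x < e.
Proof.
move=> e0; pose F (k : nat) : set 'rV[R]_n := [set y | k%:R <= enorm y].
have mF k : borel (F k).
  by apply: closed_borel; apply: closed_superlevel; exact: enorm_continuous.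
have [|i j ij||k Pk] := @measure_bigcap_lt _ _ _ P F e%:E mF.
- by apply: le_lt_trans (ltry 1); exact: probability_le1.
- by apply/subsetPset => y; apply: le_trans; rewrite ler_nat.
- rewrite (_ : \bigcap_k F k = set0) ?measure0 ?lte_fin//.
  apply/seteqP; split => // y /(_ (Num.truncn (enorm y)).+1 I).
  by rewrite /F/= leNgt truncnS_gt.
exists k%:R => x kx; rewrite -lte_fin.
apply: le_lt_trans (depth_le_tail x) (le_lt_trans _ Pk).
apply: le_measure; rewrite ?inE//; last by move=> y; exact: le_trans kx.
by apply: closed_borel; apply: closed_superlevel; exact: enorm_continuous.
Qed.

Lemma closed_central_region a : closed (central_region (probfun P) a).
Proof.
rewrite -openC openE => x /= /negP.
rewrite -ltNge => /depth_upper_semicontinuous[V Vx Va].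
by apply: filterS Vx => y /Va; rewrite /= ltNge => /negP.
Qed.

Lemma compact_central_region a : 0 < a ->
  compact (central_region (probfun P) a).
Proof.
move=> a0; have [M HD_lt] := depth_vanishes a0.
apply: closed_sub_cball_compact (@closed_central_region a) _ => x ax.
apply: le_trans (normr_le_enorm x) _; rewrite leNgt; apply/negP => /ltW/HD_lt.
by rewrite ltNge => /negP; exact.
Qed.

(* If [HD x < HD z], some [u] separates [x] from [z], and the disjoint
   halfspaces [u.y <= u.x] and [u.y >= u.z] have total mass more than [1]. *)
Lemma depth_ge_half_max x z : 1 / 2 <= HD x -> HD z <= HD x.
Proof.
move=> x2; rewrite leNgt; apply/negP => /depth_ltP[u uz].
have ux_lt_uz : dotv u x < dotv u z.
  rewrite ltNge; apply/negP => /(prob_halfspace_le u) zx.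
  have := le_lt_trans (le_trans (depth_le_halfspace z u) zx) uz.
  by rewrite ltxx.
have Px := depth_le_halfspace x u; have Pz := depth_le_halfspace z (- u).
have z2 : 1 / 2 < HD z.
  by rewrite -lte_fin; apply: le_lt_trans (le_lt_trans Px uz); rewrite lee_fin.
have mx := borel_halfspace u (dotv u x).
have mz := borel_halfspace (- u) (dotv (- u) z).
have := probability_le1 P (measurableU _ _ mx mz); rewrite measureU//.
  apply/negP; rewrite -ltNge; apply: lt_le_trans (leeD Px Pz).
  by rewrite -EFinD lte_fin; lra.
apply/seteqP; split => // y []; rewrite /halfspace/= !dotvNl lerN2 => yx zy.
by have := lt_le_trans ux_lt_uz (le_trans zy yx); rewrite ltxx.
Qed.

Lemma halfspace_symmetricP x : halfspace_symmetric (probfun P) x <->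
  1 / 2 <= HD x.
Proof.
split=> [sx|x2 u c _ xc].
  apply/depth_geP => u; have [->|u0] := eqVneq u 0; last exact: sx.
  by rewrite dot0v halfspace0// probability_setT lee_fin; lra.
apply: le_trans (prob_halfspace_le u xc).
exact: (proj1 (depth_geP _ _) x2).
Qed.

End Depth.

Section Density.
Context {R : realType} {n : nat}.
Implicit Types u x y : 'rV[R]_n.

Lemma volume_hyperplane u c : u != 0 -> volume n [set y | dotv u y = c] = 0%E.
Proof.
case: n u => [|m] u u0; first by rewrite thinmx0 eqxx in u0.
have [line [k [k0 lineD parallel]]] := volume_parallel_lines u0.
have [mchord _ volH] := parallel _ (borel_hyperplane u c).
have : (k%:E * volume m.+1 [set y | dotv u y = c])%E = 0%E.
  rewrite volH; apply: integral0_eq => v _; apply/eqP.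
  rewrite eq_le measure_ge0 andbT.
  apply: lebesgue_measure_le_diam => // p q; rewrite /preimage/= => uvp.
  have -> : line v q = line v p + (q - p) *: u by rewrite -lineD addrC subrK.
  rewrite dotvDr dotvZr uvp => /eqP.
  rewrite -[X in _ == X]addr0 (inj_eq (addrI c)).
  by rewrite mulf_eq0 dotv_eq0 (negbTE u0) orbF => /eqP ->.
by move/eqP; rewrite mule_eq0 eqe gt_eqF//= => /eqP.
Qed.

Variable P : probability (Borel_Rd R n) R.
Local Notation HD := (halfspace_depth (probfun P)).

Lemma density_null (N : set 'rV[R]_n) : has_density P -> borel N ->
  volume n N = 0%E -> P N = 0%E.
Proof.
move=> [f [mf f0 Pf]] mN N0.
rewrite Pf// (@iter_intE _ n (fun y => (f y * \1_N y)%:E)).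
- rewrite (_ : (fun y => _) = (EFin \o f) \_ N); last first.
    apply/funext => y; rewrite patchE indicE.
    by case: ifP => _; rewrite ?mulr1 ?mulr0.
  rewrite -integral_mkcond null_set_integral//.
  exact/measurable_EFinP/measurable_funTS.
- by apply/measurable_EFinP; apply: measurable_funM => //;
    exact: measurable_indic.
- by move=> y; rewrite lee_fin mulr_ge0.
Qed.

Lemma density_open_halfspace u c : has_density P -> u != 0 ->
  P (open_halfspace u c) = P (halfspace u c).
Proof.
move=> dP u0; have mH := borel_hyperplane u c.
have -> : halfspace u c = open_halfspace u c `|` [set y | dotv u y = c].
  apply/seteqP; split => y; rewrite /halfspace/open_halfspace/=.
    by rewrite le_eqVlt => /predU1P[|]; [right|left].
  by case=> [/ltW|->].
rewrite measureU//.
- have null := density_null dP mH (volume_hyperplane c u0).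
  by rewrite [X in (_ + X)%E]null adde0.
- by apply: open_borel; exact: open_open_halfspace.
- apply/seteqP; split => // y []; rewrite /open_halfspace/= => + yc.
  by rewrite yc ltxx.
Qed.

(* The open halfspace is exhausted by the closed sets of points common to all
   the halfspaces close to the given one. *)
Lemma prob_halfspace_lower_semicontinuous a u x :
  (a < P (open_halfspace u (dotv u x)))%E ->
  \forall u' \near u & x' \near x, (a < P (halfspace u' (dotv u' x')))%E.
Proof.
move=> aP; pose common (k : nat) : set 'rV[R]_n :=
  \bigcap_(p in ball (u, x) k.+1%:R^-1) halfspace p.1 (dotv p.1 p.2).
have mcommon k : borel (common k).
  by apply: closed_borel; apply: closed_bigI => p _; exact: closed_halfspace.
have [|i j ij||k aPk] := @measure_bigcup_gt _ _ _ P common a.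
- exact: mcommon.
- apply/subsetPset => y yi p pj; apply: yi; apply: le_ball pj.
  by rewrite lef_pV2 ?posrE// ler_nat.
- apply: lt_le_trans aP _; apply: le_measure; rewrite ?inE.
  + by apply: open_borel; exact: open_open_halfspace.
  + exact: bigcupT_measurable.
  move=> y; rewrite /open_halfspace/= => yx.
  have gap_cvg :
      dotv p.1 p.2 - dotv p.1 y @[p --> (u, x)] --> dotv u x - dotv u y.
    apply: cvgB; first by apply: cvg_dotv; [exact: cvg_fst|exact: cvg_snd].
    by apply: cvg_dotv; [exact: cvg_fst|exact: cvg_cst].
  have gap0 : 0 < dotv u x - dotv u y by rewrite subr_gt0.
  have /nbhs_ballP[e /= e0 eball] :
      nbhs (u, x) [set p | 0 < dotv p.1 p.2 - dotv p.1 y].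
    exact: cvgr_gt gap_cvg _ gap0.
  have /ltr_add_invr[k] := e0; rewrite add0r => ke.
  exists k => // p pk; rewrite /halfspace/= -subr_ge0 ltW//; apply: eball.
  exact: le_ball (ltW ke) _ pk.
have : \forall p \near (u, x), ball (u, x) k.+1%:R^-1 p by exact: nbhsx_ballx.
apply: filterS => p pk; apply: lt_le_trans aPk _.
apply: le_measure; rewrite ?inE.
- exact: mcommon.
- exact: borel_halfspace.
- by move=> y; exact.
Qed.

Lemma density_depth_lower_semicontinuous x a : has_density P -> a < HD x ->
  \forall x' \near x, a < HD x'.
Proof.
move=> dP ax; pose b := (a + HD x) / 2.
have [ab bx] : a < b /\ b < HD x by rewrite /b; split; lra.
pose deep x' u := (b%:E < P (halfspace u (dotv u x')))%E.
have : \forall x' \near x, [set u | `|u| = 1] `<=` deep x'.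
  have near_cover :=
    proj1 (compact_near_coveringP _) (@unit_sphere_compact R n).
  apply: (near_cover _ (nbhs x) deep) => u u1.
  apply: prob_halfspace_lower_semicontinuous.
  rewrite density_open_halfspace//; last by rewrite -normr_eq0 u1 oner_eq0.
  by apply: lt_le_trans (depth_le_halfspace P x u); rewrite lte_fin.
apply: filterS => x' unit_dirs; apply: (lt_le_trans ab).
apply: depth_ge_unit_directions => [|u u1]; last exact/ltW/unit_dirs.
exact: le_trans (ltW bx) (depth_le1 P x).
Qed.

Lemma density_depth_continuous : has_density P -> continuous HD.
Proof.
move=> dP; apply: semicontinuous_continuous => x a.
  by move=> /depth_upper_semicontinuous[V Vx HDV]; apply: filterS Vx;
    exact: HDV.
exact: density_depth_lower_semicontinuous.
Qed.

End Density.

Section AffineInvariance.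
Context {R : realType} {n : nat}.
Implicit Types (mu : set 'rV[R]_n -> \bar R) (A : 'M[R]_n) (b x : 'rV[R]_n).

Lemma depth_affine mu A b x : A \in unitmx ->
  halfspace_depth (law mu (fun y => y *m A^T + b)) (x *m A^T + b) =
    halfspace_depth mu x.
Proof.
move=> uA; rewrite /halfspace_depth; congr (fine (ereal_inf _)).
have lawE u : law mu (fun y => y *m A^T + b)
      [set y | dotv u y <= dotv u (x *m A^T + b)] =
    mu [set y | dotv (u *m A) y <= dotv (u *m A) x].
  rewrite /law; congr mu; apply/funext => y /=.
  by rewrite !dotvDr lerD2r !dotv_mulmx.
apply/seteqP; split => [_ [u _ <-]|_ [u _ <-]]; first by exists (u *m A).
by exists (u *m invmx A) => //; rewrite lawE mulmxKV.
Qed.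

Lemma central_region_affine mu A b a : A \in unitmx ->
  central_region (law mu (fun y => y *m A^T + b)) a =
  (fun w => (w - b) *m invmx A^T) @^-1` central_region mu a.
Proof.
move=> uA; apply/funext => w; rewrite /central_region/preimage/=.
rewrite -(depth_affine mu b ((w - b) *m invmx A^T) uA).
by rewrite mulmxKV ?unitmx_tr// subrK.
Qed.

End AffineInvariance.

Lemma ge0_cvge0 {R : realType} {T : Type} {F : set_system T} {FF : Filter F}
    (f : T -> \bar R) :
  (forall t, 0 <= f t)%E ->
  (forall e, 0 < e -> \forall t \near F, (f t <= e%:E)%E) ->
  f @ F --> 0%E.
Proof.
move=> f_ge0 f_small; have fin t e : (f t <= e%:E)%E -> f t \is a fin_num.
  by move=> fe; rewrite ge0_fin_numE//; exact: le_lt_trans fe (ltry _).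
apply/fine_cvgP; split; first by apply: filterS (f_small 1 ltr01) => t /fin.
apply/cvgrPdist_le => e e0; apply: filterS (f_small e e0) => t fe /=.
by rewrite sub0r normrN ger0_norm ?fine_ge0// -lee_fin fineK// (fin t e).
Qed.

Section IlluminationDepth.
Context {R : realType} {n : nat} (P : probability (Borel_Rd R n) R) (alpha : R).
Hypotheses (alpha_gt0 : 0 < alpha)
  (alpha_lt : (alpha%:E < max_depth (probfun P))%E).
Hypothesis vol_gt0 : (0 < vol (central_region (probfun P) alpha))%E.
Implicit Types u x y : 'rV[R]_n.

Local Notation HD := (halfspace_depth (probfun P)).
Local Notation K := (central_region (probfun P) alpha).
Local Notation ID := (illum_depth (probfun P) alpha).
Local Notation volK := (fine (volume n K)).

Let compactK : compact K. Proof. exact: compact_central_region. Qed.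
Let convexK : convex_set K. Proof. exact: convex_central_region. Qed.

Let volKE : vol K = volK%:E.
Proof. by rewrite volE -?volume_compact//; exact: compact_borel. Qed.

Let volK_gt0 : 0 < volK. Proof. by move: vol_gt0; rewrite volKE lte_fin. Qed.

Lemma deep_point : exists z, alpha < HD z.
Proof.
by have /ereal_sup_gt[_ [z _ <-]] := alpha_lt; rewrite lte_fin; exists z.
Qed.

Let K_neq0 : K !=set0. Proof. by have [z /ltW] := deep_point; exists z. Qed.

Lemma illum_depthE x : ID x = (HD x, illum_vol K x / volK).
Proof. by rewrite /illum_depth illuminationE// volKE. Qed.

Lemma illum_depth_affine (A : 'M[R]_n) b x : A \in unitmx ->
  illum_depth (law (probfun P) (fun y => y *m A^T + b)) alpha (x *m A^T + b) =
    ID x.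
Proof.
move=> uA; have uAT : A^T \in unitmx by rewrite unitmx_tr.
have [|c c0 scale] := @volume_affine R n (invmx A^T);
  first by rewrite unitmx_inv.
pose f (w : 'rV[R]_n) := (w - b) *m invmx A^T; pose g y := y *m A^T + b.
have fK : cancel f g by move=> w; rewrite /f/g mulmxKV// subrK.
have gK : cancel g f by move=> y; rewrite /f/g addrK mulmxK.
have affine_f : affine_map f by exact: affine_map_mulmx.
have vol_preimage C : borel C -> vol (f @^-1` C) = (c%:E * volume n C)%E.
  move=> mC; rewrite volE; first exact: scale.
  exact: (borel_preimage_shift (- b) (borel_preimage_mulmxr _ mC)).
rewrite illum_depthE /illum_depth depth_affine// central_region_affine// -/f.
rewrite (illumination_preimage _ _ affine_f fK gK) -/(g x) gK conv_setU1//.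
rewrite !vol_preimage; [|exact: compact_borel|exact: borel_point_join].
rewrite volume_point_join// volume_compact// -!EFinM/=.
by congr (_, _); field; rewrite !gt_eqF.
Qed.

Lemma halfspace_symmetric_illum_depth x : halfspace_symmetric (probfun P) x <->
  exists c : R, 1 / 2 <= c /\ ID x = (c, 1).
Proof.
rewrite halfspace_symmetricP illum_depthE; split => [x2|[c [c2 [-> _]]]]//.
have [z z_deep] := deep_point.
have Kx : K x by exact: le_trans (ltW z_deep) (depth_ge_half_max z x2).
by exists (HD x); split => //; rewrite illum_vol_id ?divff ?gt_eqF.
Qed.

Lemma illum_depth_ray x u s t :
  (HD x)%:E = max_depth (probfun P) -> 0 <= s -> s <= t ->
  (ID (x + t *: u)).1 <= (ID (x + s *: u)).1 /\
  (ID (x + s *: u)).2 <= (ID (x + t *: u)).2.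
Proof.
move=> x_max s0; rewrite le_eqVlt => /predU1P[->//|st].
have t0 := le_lt_trans s0 st.
have Kx : K x by rewrite /central_region/= -lee_fin x_max ltW.
pose r := s / t; have r0 : 0 <= r by rewrite divr_ge0// ltW.
have r1 : r <= 1 by rewrite ler_pdivrMr// mul1r ltW.
have -> : x + s *: u = (1 - r) *: x + r *: (x + t *: u).
  by rewrite scalerDr addrA -scalerDl subrK scale1r scalerA divfK ?gt_eqF.
rewrite !illum_depthE/=; split.
  have /convex_setP := @convex_central_region _ _ P (HD (x + t *: u)).
  apply => //; last exact: lexx.
  rewrite /central_region/= -lee_fin x_max.
  by apply: ereal_sup_ubound; exists (x + t *: u).
rewrite ler_pM2r ?invr_gt0//.
have /convex_functionP convex_ill := illum_vol_convex compactK convexK.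
apply: le_trans (convex_ill _ _ _ r0 r1) _; rewrite (illum_vol_id convexK Kx).
by have := illum_vol_ge compactK (x + t *: u); nra.
Qed.

Lemma illum_depth_level_set c1 c2 :
  let S := [set x | c1 <= (ID x).1 /\ (ID x).2 <= c2] in
  convex_set S /\ (0 < c1 -> compact S).
Proof.
move=> S; have -> : S =
    central_region (probfun P) c1 `&` [set x | illum_vol K x <= c2 * volK].
  by apply/funext => x; rewrite /S/mkset illum_depthE ler_pdivrMr.
split=> [|c1_gt0].
  apply: convex_setI; first exact: convex_central_region.
  exact: convex_sublevel (illum_vol_convex compactK convexK).
apply: compact_closedI; first exact: compact_central_region.
by apply: closed_sublevel; exact: illum_vol_continuous.
Qed.

Lemma illum_depth2_continuous : continuous (fun x => (ID x).2).
Proof.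
under eq_fun do rewrite illum_depthE.
move=> x; have cill := illum_vol_continuous compactK convexK (x := x).
exact: cvgM cill (cvg_cst _).
Qed.

Lemma illum_depth_continuous : has_density P -> continuous (fun x => ID x).
Proof.
move=> dP x; have cHD := density_depth_continuous dP (x := x).
exact: (cvg_pair cHD (illum_depth2_continuous (x := x))).
Qed.

Lemma illum_depth1_vanishes : (0 < n)%N ->
  ereal_sup [set (ID x).1%:E | x in [set x | r <= enorm x]]
    @[r --> +oo] --> 0%E.
Proof.
move=> n_gt0; apply: ge0_cvge0 => [r|e e0].
  pose x : 'rV[R]_n := const_mx r; have rx : r <= enorm x.
    apply: le_trans (normr_le_enorm x).
    by apply: le_trans (normr_coord x (Ordinal n_gt0)); rewrite mxE ler_norm.
  apply: le_ereal_sup_tmp; exists (ID x).1%:E; first by exists x.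
  by rewrite lee_fin depth_ge0.
have [M HD_lt] := depth_vanishes P e0; near=> r.
apply: ge_ereal_sup => _ [x rx <-]; rewrite lee_fin.
apply/ltW/HD_lt; apply: le_trans rx.
by near: r; apply: nbhs_pinfty_ge; exact: num_real.
Unshelve. all: by end_near.
Qed.

Lemma illum_depth2_diverges :
  ereal_inf [set (ID x).2%:E | x in [set x | r <= enorm x]]
    @[r --> +oo] --> +oo%E.
Proof.
apply/cvgeyPge => A; have [k Kk] := K_neq0.
have [D ill_ge] := illum_vol_diverges compactK convexK Kk volK_gt0 (A * volK).
near=> r; apply: le_ereal_inf_tmp => _ [x rx <-].
rewrite lee_fin illum_depthE/= ler_pdivlMr//; apply: ill_ge.
rewrite leNgt; apply/negP => xD.
have : r <= Num.sqrt n%:R * D.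
  by apply: le_trans rx (le_trans (enorm_le_normr x) _);
    rewrite ler_wpM2l ?sqrtr_ge0// ltW.
apply/negP; rewrite -ltNge.
by near: r; apply: nbhs_pinfty_gt; exact: num_real.
Unshelve. all: by end_near.
Qed.

End IlluminationDepth.

Theorem theorem1 (R : realType) (d : nat) (P : probability (Borel_Rd R d) R)
  (alpha : R) :
  (0 < d)%N ->
  0 < alpha -> (alpha%:E < max_depth (probfun P))%E ->
  (0 < vol (central_region (probfun P) alpha))%E ->
  (* (i) affine invariance *)
   (forall (A : 'M[R]_d) (b x : 'rV[R]_d), A \in unitmx ->
      illum_depth (law (probfun P) (fun y => y *m A^T + b)) alpha (x *m A^T + b)
      = illum_depth (probfun P) alpha x) /\
   (* (ii) halfspace symmetry *)
   (forall x : 'rV[R]_d, halfspace_symmetric (probfun P) x <->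
      exists c : R, 1/2 <= c /\ illum_depth (probfun P) alpha x = (c, 1)) /\
   (* (iii) monotonicity along rays from a deepest point *)
   (forall x : 'rV[R]_d, (halfspace_depth (probfun P) x)%:E = max_depth (probfun P) ->
      forall (u : 'rV[R]_d) (s t : R), 0 <= s -> s <= t ->
        (illum_depth (probfun P) alpha (x + t *: u)).1
          <= (illum_depth (probfun P) alpha (x + s *: u)).1 /\
        (illum_depth (probfun P) alpha (x + s *: u)).2
          <= (illum_depth (probfun P) alpha (x + t *: u)).2) /\
   (* (iv) convexity / compactness of level sets *)
   (forall c1 c2 : R,
      let S := [set x : 'rV[R]_d | c1 <= (illum_depth (probfun P) alpha x).1 /\
                                   (illum_depth (probfun P) alpha x).2 <= c2] in
      convex_set S /\ (0 < c1 -> compact S)) /\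
   (* (v) semicontinuity / continuity *)
   [/\ upper_semicontinuous (fun x => (illum_depth (probfun P) alpha x).1),
       continuous (fun x : 'rV[R]_d => (illum_depth (probfun P) alpha x).2) &
       (has_density P -> continuous (fun x : 'rV[R]_d => illum_depth (probfun P) alpha x))] /\
   (* (vi) behaviour at infinity *)
   (ereal_sup [set (illum_depth (probfun P) alpha x).1%:E | x in [set x | r <= enorm x]]
      @[r --> +oo] --> 0%E) /\
   (ereal_inf [set (illum_depth (probfun P) alpha x).2%:E | x in [set x | r <= enorm x]]
      @[r --> +oo] --> +oo%E).
Proof.
move=> d_gt0 alpha_gt0 alpha_lt vol_gt0.
split; first by move=> A b x; exact: illum_depth_affine.
split; first by move=> x; exact: halfspace_symmetric_illum_depth.
split; first by move=> x x_deepest u s t; exact: illum_depth_ray.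
split; first exact: illum_depth_level_set.
split; first split.
- exact: depth_upper_semicontinuous.
- exact: illum_depth2_continuous.
- exact: illum_depth_continuous.
by split; [exact: illum_depth1_vanishes|exact: illum_depth2_diverges].
Qed.
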